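(* The randomized online algorithm $\mathrm{Rand}$ (defined in the context) is $8\ln n$-competitive for online MinLA when all revealed graphs are collections of lines. That is, for every node set $V$ with $|V|=n$ and every line instance $\sigma=(\pi_0;G_0,\dots,G_k)$ on $V$, $$\mathbb{E}[\mathrm{Rand}(\sigma)]\le 8\ln n\cdot \mathrm{Opt}(\sigma).$$
   Context: Let $V$ be a set of $n$ nodes. A permutation is a bijection $\pi:V\to\{1,\dots,n\}$ ($\pi(x)$ is the position of $x$; smaller positions are further left). A MinLA of a graph $G=(V,E)$ is a permutation $\pi$ minimizing $\sum_{\{x,y\}\in E}|\pi(x)-\pi(y)|$ among all permutations. $d(\pi,\pi')$ is the Kendall tau distance: the minimum number of swaps of adjacent elements transforming $\pi$ into $\pi'$. Line instance: an arbitrary initial permutation $\pi_0$ and a sequence $G_0,\dots,G_k$ of graphs on $V$, where $G_0$ has no edges, every $G_i$ is a disjoint union of paths (isolated nodes are paths with one node), and $G_{i+1}$ is obtained from $G_i$ by adding one edge $\{x_i,z_i\}$ between two distinct components. Let $X_i\ni x_i$ and $Z_i\ni z_i$ be the node sets of the components of $G_i$ containing $x_i$ and $z_i$. Feasible solution: permutations $\pi_1,\dots,\pi_k$ such that $\pi_i$ is a MinLA of $G_i$ for each $i$; its cost is $\sum_{i=0}^{k-1}d(\pi_i,\pi_{i+1})$. An online algorithm must choose $\pi_i$ knowing only $\pi_0,G_0,\dots,G_i$. $\mathrm{Opt}(\sigma)$ is the minimum cost of a feasible solution of the instance $\sigma$ (full knowledge of $\sigma$). A randomized algorithm is $c$-competitive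 (against the oblivious adversary) if on every fixed instance $\sigma$ its expected cost is at most $c\cdot\mathrm{Opt}(\sigma)$. Algorithm $\mathrm{Rand}$ (lines): when $G_{i+1}$ is revealed, it updates $\pi_i$ in two parts, using fresh independent coins. (1) Moving part: with probability $|Z_i|/(|X_i|+|Z_i|)$, move the block $X_i$ (keeping its internal order) towards $Z_i$ past all nodes lying between them until it is adjacent to $Z_i$; with the remaining probability $|X_i|/(|X_i|+|Z_i|)$, move the block $Z_i$ (keeping its internal order) towards $X_i$ until it is adjacent to $X_i$. (2) Rearranging part: the block $X_i\cup Z_i$ must now be put in one of the two orders (mutually reverse) in which its nodes appear along the path of $G_{i+1}$ on $X_i\cup Z_i$. Each of the two target orders is reached by some combination of: reversing $X_i$ (cost $\binom{|X_i|}{2}$), swapping the blocks $X_i$ and $Z_i$ (cost $|X_i||Z_i|$), reversing $Z_i$ (cost $\binom{|Z_i|}{2}$); the costs of the two targets sum to $\binom{|X_i|+|Z_i|}{2}$. $\mathrm{Rand}$ chooses each target with probability equal to the cost of the other target divided by $\binom{|X_i|+|Z_i|}{2}$. (For example, if $X_i$ is to the left of $Z_i$, and $x_i$, $z_i$ are the leftmost nodes of their blocks, it reverses $X_i$ with probability $(|X_i||Z_i|+\binom{|Z_i|}{2})/\binom{|X_i|+|Z_i|}{2}$, and otherwise swaps $X_i$ with $Z_i$ and reverses $Z_i$.) The result is $\pi_{i+1}$; the cost $\mathrm{Rand}(\sigma)$ is the total number of adjacent swaps performed in both parts over all updates. *)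

(* Defs.v *)
From HB Require Import structures.
From mathcomp Require Import all_boot all_order all_fingroup all_algebra.
From mathcomp Require Import reals exp.
From mathcomp Require Import zify.

Set Implicit Arguments.
Unset Strict Implicit.
Unset Printing Implicit Defensive.

Import Order.TTheory GRing.Theory Num.Theory.

(* A permutation of V, i.e. a bijection pi : V -> {1, .., n}, is encoded by the
   list of all the nodes from left to right; pi x is then one more than the
   index of x in this list (see pos_inj, pos_lt and arrangement_of_bij).  The
   shift by one is irrelevant since only differences and comparisons of
   positions are used. *)
Definition arrangement (V : finType) : finType :=
  seq_sub (permutations (enum V)).

Definition pos (V : finType) (p : arrangement V) (x : V) : nat :=
  index x (val p).

Lemma arrangement_perm (V : finType) (p : arrangement V) :
  perm_eq (val p) (enum V).
Proof. by rewrite -mem_permutations; apply: valP. Qed.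

Lemma arrangement_uniq (V : finType) (p : arrangement V) : uniq (val p).
Proof. by rewrite (perm_uniq (arrangement_perm p)) enum_uniq. Qed.

Lemma mem_arrangement (V : finType) (p : arrangement V) (x : V) : x \in val p.
Proof. by rewrite (perm_mem (arrangement_perm p)) mem_enum. Qed.

Lemma pos_inj (V : finType) (p : arrangement V) : injective (pos p).
Proof.
by move=> x y exy; rewrite -(nth_index x (mem_arrangement p x)) -/(pos p x) exy
  nth_index // mem_arrangement.
Qed.

Lemma pos_lt (V : finType) (p : arrangement V) (x : V) : pos p x < #|V|.
Proof.
by rewrite cardE -(perm_size (arrangement_perm p)) index_mem mem_arrangement.
Qed.

Lemma arrangement_of_bij (V : finType) (f : V -> 'I_#|V|) :
  bijective f -> exists! p : arrangement V, forall x, pos p x = f x.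
Proof.
case=> g fK gK; pose s := [seq g i | i <- enum 'I_#|V|].
have us : uniq s by rewrite map_inj_uniq ?enum_uniq //; apply: can_inj gK.
have ps : s \in permutations (enum V).
  rewrite mem_permutations; apply: uniq_perm => [//||x]; first exact: enum_uniq.
  by rewrite mem_enum; apply/mapP; exists (f x); rewrite ?fK ?mem_enum.
exists (SeqSub ps); split=> [x|q fq].
  rewrite /pos /= -{1}(fK x) index_map ?index_enum_ord //.
  exact: can_inj gK.
apply: val_inj => /=.
have sz : size s = size (val q).
  by rewrite size_map -cardE card_ord (perm_size (arrangement_perm q)) -cardE.
case: (pickP (mem V)) => [x0 _|V0]; last first.
  have sV : size s = 0 by rewrite size_map -cardE card_ord; apply: eq_card0.
  by move: (sV); rewrite sz => /size0nil ->; apply: size0nil.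
apply: (@eq_from_nth _ x0) => // i lti.
have lti' : i < #|V| by move: lti; rewrite size_map -cardE card_ord.
rewrite (nth_map (Ordinal lti')) -?cardE ?card_ord //.
rewrite (nth_ord_enum (Ordinal lti') (Ordinal lti')).
rewrite -(nth_index x0 (mem_arrangement q (g (Ordinal lti')))).
by rewrite -/(pos q _) fq gK.
Qed.

(* q is obtained from p by exchanging two nodes at consecutive positions. *)
Definition adj_swap (V : finType) (p q : arrangement V) : bool :=
  [exists x, exists y,
    (pos p y == (pos p x).+1) && (val q == [seq tperm x y v | v <- val p])].

Definition swap_reach (V : finType) (p q : arrangement V) (m : nat) : bool :=
  [exists s : m.-tuple (arrangement V), path (@adj_swap V) p s && (last p s == q)].

Lemma adj_swap_cat (V : finType) (p q : arrangement V) s (a b : V) t :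
  val p = s ++ a :: b :: t -> val q = s ++ b :: a :: t -> adj_swap p q.
Proof.
move=> ep eq; apply/existsP; exists a; apply/existsP; exists b.
have := arrangement_uniq p; rewrite /pos ep eq cat_uniq /= !inE !negb_or.
case/and3P=> us /and3P[as_ bs hs] /and3P[/andP[nab nat_] nbt ut].
rewrite !index_cat (negbTE as_) (negbTE bs) /= !eqxx (negbTE nab).
rewrite addn1 addn0 eqxx map_cat /= tpermL tpermR /=; apply/eqP.
have fixed u : a \notin u -> b \notin u -> u = [seq tperm a b v | v <- u].
  move=> au bu; rewrite -[LHS]map_id; apply/eq_in_map => v vu.
  by rewrite tpermD //; apply/eqP => ev; move: vu; rewrite -ev ?(negbTE au) ?(negbTE bu).
by rewrite -!fixed.
Qed.

Lemma connect_adj_swap (V : finType) (p q : arrangement V) :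
  connect (@adj_swap V) p q.
Proof.
have mk (p' : arrangement V) s : perm_eq s (val p') ->
    {r : arrangement V | val r = s}.
  move=> ps; have hs : s \in permutations (enum V).
    by rewrite mem_permutations (perm_trans ps) // arrangement_perm.
  by exists (SeqSub hs).
have bubble x s3 s2 : forall s1 (p q : arrangement V),
    val p = s1 ++ s2 ++ x :: s3 -> val q = s1 ++ x :: s2 ++ s3 ->
    connect (@adj_swap V) p q.
  elim: s2 => [|a s2 IH] s1 p' q' ep eq.
    by have -> : p' = q' by apply: val_inj; rewrite ep eq.
  have pr : perm_eq (s1 ++ a :: x :: s2 ++ s3) (val p').
    by rewrite ep perm_cat2l /= perm_cons -cat1s perm_catCA.
  have [r er] := mk p' _ pr.
  apply: (connect_trans (y := r)); last exact/connect1/(adj_swap_cat er eq).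
  by apply: (IH (rcons s1 a)); rewrite ?ep ?er cat_rcons.
have gen t : forall s1 s (p q : arrangement V), perm_eq s t ->
    val p = s1 ++ s -> val q = s1 ++ t -> connect (@adj_swap V) p q.
  elim: t => [|x t IH] s1 s p' q' pst ep eq.
    have s0 : s = [::] by apply: perm_nilP.
    by have -> : p' = q' by apply: val_inj; rewrite ep eq s0.
  have xs : x \in s by rewrite (perm_mem pst) mem_head.
  case: (splitPr xs) ep pst => s2 s3 ep pst.
  have pr : perm_eq (s1 ++ x :: s2 ++ s3) (val p').
    by rewrite ep perm_cat2l -cat1s perm_catCA.
  have [r er] := mk p' _ pr.
  apply: (connect_trans (y := r)); first exact: bubble ep er.
  apply: (IH (rcons s1 x) (s2 ++ s3)); rewrite ?cat_rcons //.
  by rewrite -(perm_cons x) (perm_trans _ pst) // -cat1s perm_catCA.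
apply: (gen (val q) [::] (val p)) => //.
by rewrite (perm_trans (arrangement_perm p)) // perm_sym arrangement_perm.
Qed.

Lemma swap_reach_ex (V : finType) (p q : arrangement V) :
  exists m, swap_reach p q m.
Proof.
have /connectP[s ps ->] := connect_adj_swap p q.
by exists (size s); apply/existsP; exists (in_tuple s); rewrite ps eqxx.
Qed.

Definition kendall_tau (V : finType) (p q : arrangement V) : nat :=
  ex_minn (swap_reach_ex p q).

(* The graph on V whose edges are the {e.1, e.2} for e in es. *)
Definition graph (V : finType) (es : seq (V * V)) : rel V :=
  fun x y => ((x, y) \in es) || ((y, x) \in es).

Definition component (V : finType) (G : rel V) (x : V) : {set V} :=
  [set y | connect G x y].

(* p lists the nodes of C, and the edges of G inside C are exactly the pairs of
   consecutive nodes of p. *)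
Definition path_order (V : finType) (G : rel V) (C : {set V}) (p : seq V) :
    bool :=
  [&& uniq p, [forall x, (x \in p) == (x \in C)] &
      [forall x in C, forall y in C,
         G x y == ((index y p == (index x p).+1) || (index x p == (index y p).+1))]].

Definition disjoint_paths (V : finType) (G : rel V) : Prop :=
  forall x, exists p, path_order G (component G x) p.

(* The instance is given by the initial permutation and the list es of the
   added edges (x_i, z_i): G_i is graph (take i es). *)
Definition line_instance (V : finType) (es : seq (V * V)) : Prop :=
  (forall i, i <= size es -> disjoint_paths (graph (take i es))) /\
  (forall es1 x z es2, es = rcons es1 (x, z) ++ es2 ->
     component (graph es1) x != component (graph es1) z).

(* Each edge {x, y} of G is counted once, at its left end x. *)
Definition arrangement_cost (V : finType) (G : rel V) (p : arrangement V) : nat :=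
  \sum_x \sum_(y | G x y && (pos p x < pos p y)) (pos p y - pos p x).

Definition minla (V : finType) (G : rel V) (p : arrangement V) : bool :=
  [forall q, arrangement_cost G p <= arrangement_cost G q].

Definition feasible (V : finType) (es : seq (V * V))
    (sol : (size es).-tuple (arrangement V)) : bool :=
  [forall i : 'I_(size es), minla (graph (take i.+1 es)) (tnth sol i)].

Definition solution_cost (V : finType) (pi0 : arrangement V)
    (sol : seq (arrangement V)) : nat :=
  \sum_(i < size sol)
    kendall_tau (nth pi0 (pi0 :: sol) i) (nth pi0 (pi0 :: sol) i.+1).

Lemma feasible_ex (V : finType) (pi0 : arrangement V) (es : seq (V * V)) :
  exists c, [exists sol : (size es).-tuple (arrangement V),
    feasible sol && (solution_cost pi0 sol == c)].
Proof.
pose best G := [arg min_(p < pi0) arrangement_cost G p].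
pose sol := [tuple best (graph (take i.+1 es)) | i < size es].
exists (solution_cost pi0 sol); apply/existsP; exists sol; rewrite eqxx andbT.
apply/forallP=> i; rewrite tnth_mktuple; apply/forallP => q.
by rewrite /best; case: arg_minnP => // p _; apply.
Qed.

Definition opt (V : finType) (pi0 : arrangement V) (es : seq (V * V)) : nat :=
  ex_minn (feasible_ex pi0 es).

(* One update of Rand: pi is the current permutation, the edges in hist have
   already been revealed and the edge e is being revealed. *)
Definition left_node (V : finType) (pi : arrangement V) (e : V * V) : V :=
  if pos pi e.1 < pos pi e.2 then e.1 else e.2.

Definition right_node (V : finType) (pi : arrangement V) (e : V * V) : V :=
  if pos pi e.1 < pos pi e.2 then e.2 else e.1.

Definition block (V : finType) (hist : seq (V * V)) (pi : arrangement V) (x : V) :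
    seq V :=
  [seq v <- val pi | v \in component (graph hist) x].

Definition outside (V : finType) (hist : seq (V * V)) (e : V * V) (v : V) : bool :=
  (v \notin component (graph hist) e.1) && (v \notin component (graph hist) e.2).

Section Update.
Context {V : finType} (hist : seq (V * V)) (pi : arrangement V) (e : V * V).

(* When the two components are contiguous in pi, pi is the concatenation
   before_blocks ++ left_block ++ between_blocks ++ right_block ++ after_blocks,
   where {left_block, right_block} = {X, Z}. *)
Definition left_block : seq V := block hist pi (left_node pi e).
Definition right_block : seq V := block hist pi (right_node pi e).
Definition before_blocks : seq V :=
  [seq v <- val pi | outside hist e v && (pos pi v < pos pi (left_node pi e))].
Definition between_blocks : seq V :=
  [seq v <- val pi | outside hist e v &&
     (pos pi (left_node pi e) < pos pi v < pos pi (right_node pi e))].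
Definition after_blocks : seq V :=
  [seq v <- val pi | outside hist e v && (pos pi (right_node pi e) < pos pi v)].

(* The coin a of the moving part tells whether the left block is the one that
   moves; in either case a block moves with probability proportional to the
   size of the other one. *)
Definition move_cost (a : bool) : nat :=
  (if a then size left_block else size right_block) * size between_blocks.

Definition move_prob (R : realType) (a : bool) : R :=
  ((if a then size right_block else size left_block)%:R
     / (size left_block + size right_block)%:R)%R.

(* A triple c tells whether the left block is reversed, whether the two blocks
   are swapped, and whether the right block is reversed. *)
Definition rearranged (c : bool * bool * bool) : seq V :=
  let l := if c.1.1 then rev left_block else left_block in
  let r := if c.2 then rev right_block else right_block in
  if c.1.2 then r ++ l else l ++ r.

Definition rearranged_cost (c : bool * bool * bool) : nat :=
  c.1.1 * 'C(size left_block, 2)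
  + c.1.2 * (size left_block * size right_block)
  + c.2 * 'C(size right_block, 2).

(* Some combination leading to an order along the new path; performing exactly
   the complementary operations leads to the reverse order.  Several
   combinations lead to the same order only if a block is a single node, whose
   reversal costs 0. *)
Definition base_combination : bool * bool * bool :=
  let G := graph (rcons hist e) in
  odflt (false, false, false)
    [pick c | path_order G (component G e.1) (rearranged c)].

Definition target (b : bool) : bool * bool * bool :=
  let c := base_combination in
  if b then c else (~~ c.1.1, ~~ c.1.2, ~~ c.2).

Definition target_prob (R : realType) (b : bool) : R :=
  ((rearranged_cost (target (~~ b)))%:R
     / 'C(size left_block + size right_block, 2)%:R)%R.

(* The coins of one update: w.1 for the moving part and w.2 for the
   rearranging part. *)
Definition update_listing (w : bool * bool) : seq V :=
  let t := rearranged (target w.2) in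
  before_blocks
    ++ (if w.1 then between_blocks ++ t else t ++ between_blocks)
    ++ after_blocks.

Definition update_cost (w : bool * bool) : nat :=
  move_cost w.1 + rearranged_cost (target w.2).

Definition update_prob (R : realType) (w : bool * bool) : R :=
  (move_prob R w.1 * target_prob R w.2)%R.

(* By update_listing_perm, the default value pi of insubd is never used when
   the edge e joins two distinct components. *)
Definition update (w : bool * bool) : arrangement V :=
  insubd pi (update_listing w).

Lemma update_listing_perm (w : bool * bool) :
  component (graph hist) e.1 != component (graph hist) e.2 ->
  update_listing w \in permutations (enum V).
Proof.
move=> nXZ; rewrite mem_permutations.
rewrite (perm_trans _ (arrangement_perm pi)) //.
have symG : connect_sym (graph hist).
  by apply: sym_connect_sym => x y; rewrite /graph orbC.
have dXZ v : v \in component (graph hist) e.1 ->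
    v \notin component (graph hist) e.2.
  rewrite !inE => xv; apply/negP => zv; case/eqP: nXZ.
  have xz : connect (graph hist) e.1 e.2.
    by apply: connect_trans xv _; rewrite symG.
  by apply/setP => u; rewrite !inE (same_connect symG xz).
have memX : e.1 \in component (graph hist) e.1 by rewrite inE.
have memZ : e.2 \in component (graph hist) e.2 by rewrite inE.
have permT c : perm_eq (rearranged c) (left_block ++ right_block).
  have prev b (s : seq V) : perm_eq (if b then rev s else s) s.
    by case: b => //; rewrite perm_rev.
  rewrite /rearranged; case: (c.1.2); last exact: perm_cat.
  by rewrite perm_catC; apply: perm_cat.
have lr : pos pi (left_node pi e) < pos pi (right_node pi e).
  have /eqP nxz : pos pi e.1 != pos pi e.2.
    by apply: contraNneq nXZ => /pos_inj ->.
  by rewrite /left_node /right_node; case: ifP; lia.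
have part v : (v \in component (graph hist) (left_node pi e))
  + (v \in component (graph hist) (right_node pi e))
  + (outside hist e v && (pos pi v < pos pi (left_node pi e)))
  + (outside hist e v &&
      (pos pi (left_node pi e) < pos pi v < pos pi (right_node pi e)))
  + (outside hist e v && (pos pi (right_node pi e) < pos pi v)) = 1.
  case out: (outside hist e v) => /=.
    have [/andP[nX nZ] nl nr] : [/\ outside hist e v,
        v != left_node pi e & v != right_node pi e].
      case/andP: (out) => nX nZ; split=> //; rewrite /left_node /right_node;
        case: ifP => _; apply/eqP => ev;
        by move: nX nZ; rewrite ev ?memX ?memZ.
    have /negbTE-> : v \notin component (graph hist) (left_node pi e).
      by rewrite /left_node; case: ifP.
    have /negbTE-> : v \notin component (graph hist) (right_node pi e).
      by rewrite /right_node; case: ifP.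
    have hl : pos pi v != pos pi (left_node pi e) by apply: contraNneq nl => /pos_inj ->.
    have hr : pos pi v != pos pi (right_node pi e) by apply: contraNneq nr => /pos_inj ->.
    move: lr hl hr; clear; lia.
  move: (dXZ v); move: out; rewrite /outside /left_node /right_node.
  case: ifP => _; case: (v \in component _ e.1); case: (v \in component _ e.2) => //=;
    by move=> _ /(_ isT).
apply/seq.permP => P; rewrite /update_listing.
have -> : count P (before_blocks
    ++ (if w.1 then between_blocks ++ rearranged (target w.2)
        else rearranged (target w.2) ++ between_blocks) ++ after_blocks)
  = count P left_block + count P right_block + count P before_blocks
    + count P between_blocks + count P after_blocks.
  have eT := seq.permP (permT (target w.2)) P; rewrite count_cat in eT.
  clear part; case: (w.1); rewrite !count_cat eT;
    do 5 move: (count P _) => ?; lia.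
rewrite /left_block /right_block /before_blocks /between_blocks /after_blocks.
rewrite /block !count_filter; elim: (val pi) => //= v s <-.
by move: (part v); rewrite /= !inE; case: (P v) => //=; clear; lia.
Qed.

Lemma update_prob_sum (R : realType) :
  component (graph hist) e.1 != component (graph hist) e.2 ->
  (\sum_(w : bool * bool) update_prob R w = 1)%R.
Proof.
move=> nXZ.
have gt0 x : 0 < size (block hist pi x).
  rewrite -has_predT; apply/hasP; exists x => //.
  by rewrite mem_filter mem_arrangement inE connect0.
have L0 : 0 < size left_block by apply: gt0.
have R0 : 0 < size right_block by apply: gt0.
have S0 : ((size left_block + size right_block)%:R != 0 :> R)%R.
  by rewrite pnatr_eq0 -lt0n addn_gt0 L0.
have B0 : ('C(size left_block + size right_block, 2)%:R != 0 :> R)%R.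
  by rewrite pnatr_eq0 -lt0n bin_gt0; lia.
have cs : rearranged_cost (target true) + rearranged_cost (target false)
    = 'C(size left_block + size right_block, 2).
  have binD a b : 'C(a + b, 2) = 'C(a, 2) + a * b + 'C(b, 2).
    elim: a => [|a IH]; first by rewrite bin0n.
    by rewrite addSn !binS !bin1 IH; lia.
  rewrite binD /target /rearranged_cost.
  by case: base_combination => [[[] []] []] /=; lia.
transitivity ((\sum_(a : bool) move_prob R a) * (\sum_(b : bool) target_prob R b))%R.
  by rewrite big_distrlr /= pair_big.
rewrite !big_bool /move_prob /target_prob /= -!mulrDl -!natrD.
by rewrite [in X in (_ * X)%R]addnC cs addnC !divff ?mulr1.
Qed.

End Update.

(* A sequence of coins for the whole run is a list of pairs of booleans, one
   for each update. *)
Fixpoint rand_cost (V : finType) (hist : seq (V * V)) (pi : arrangement V)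
    (es : seq (V * V)) (ws : seq (bool * bool)) : nat :=
  match es, ws with
  | e :: es', w :: ws' =>
      update_cost hist pi e w
      + rand_cost (rcons hist e) (update hist pi e w) es' ws'
  | _, _ => 0
  end.

Fixpoint rand_prob (R : realType) (V : finType) (hist : seq (V * V))
    (pi : arrangement V) (es : seq (V * V)) (ws : seq (bool * bool)) : R :=
  match es, ws with
  | e :: es', w :: ws' =>
      (update_prob hist pi e R w
       * rand_prob R (rcons hist e) (update hist pi e w) es' ws')%R
  | _, _ => 1%R
  end.

Definition expected_rand_cost (R : realType) (V : finType) (pi0 : arrangement V)
    (es : seq (V * V)) : R :=
  (\sum_(ws : (size es).-tuple (bool * bool))
     rand_prob R [::] pi0 es ws * (rand_cost [::] pi0 es ws)%:R)%R.

(* Main.v *)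
(* Every final MinLA is a MinLA of all the intermediate graphs, so Opt is at least
   half the number of (ordered) pairs on which pi0 and the last permutation q of
   an optimal solution disagree.  The number of pairs on which Rand disagrees with
   q is a martingale, even when restricted to the pairs between a joined block and
   an outside node and to the pairs inside a joined block.  Give each pair {u, v}
   the weight |X||Y| if u and v lie in distinct components X and Y, and binom(|X|, 2)
   if both lie in X.  A join that raises the weight of a disagreeing pair from w to
   w' is charged 1 - w / w' <= ln w' - ln w for it, and these charges cover the
   expected cost of the update.  Since the weights start at 1 and never exceed n^2,
   each pair that disagrees initially is charged at most 2 ln n. *)

Require Import Defs.
From mathcomp Require Import all_boot all_order all_algebra.
From mathcomp Require Import reals exp.
From mathcomp Require Import all_fingroup zify ring lra.

Set Implicit Arguments.
Unset Strict Implicit.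
Unset Printing Implicit Defensive.

Import Order.TTheory GRing.Theory Num.Theory.

(** A join changes disagreements group by group. A node between the two blocks disagrees with [q]
    for exactly one of them, say X. After the move it disagrees for the whole joined block, with
    probability |X| / (|X| + |Z|), or for none of it; this probability is w / w' for those pairs.
    Inside the joined block one of the two targets is the order of [q], and its cost c is the number
    of disagreeing pairs. Afterwards all B = binom(|X| + |Z|, 2) pairs disagree, with probability c
    / B, or none. The disagreeing pairs form up to three groups (inside X, across, inside Z) and w
    is the size of the group, so w / w' <= c / B. In both parts the expected cost is twice the
    number of disagreeing pairs times the probability that they get resolved; summing over ordered
    pairs absorbs this factor 2. With 2 ln n per ordered pair and at most 2 Opt such pairs, the
    argument yields 4 ln n, so the constant 8 leaves room. *)

(** * Duplicate-free lists as linear orders and as paths *)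

Definition prec (T : eqType) (s : seq T) (u v : T) : bool :=
  index u s < index v s.

Definition consec (T : eqType) (s : seq T) (u v : T) : bool :=
  (index v s == (index u s).+1) || (index u s == (index v s).+1).

Section Prec.
Context {T : eqType}.
Implicit Types (s t : seq T) (u v w : T) (P : pred T).

Lemma consecC s u v : consec s u v = consec s v u.
Proof. by rewrite /consec orbC. Qed.

Lemma prec_antisym s u v : u \in s -> u != v -> prec s u v = ~~ prec s v u.
Proof.
move=> us nuv; rewrite /prec -leqNgt [RHS]leq_eqVlt.
case: eqP => //= e; case/eqP: nuv.
have vs : v \in s by move: us; rewrite -!index_mem e.
by rewrite -(nth_index u us) e nth_index.
Qed.

Lemma prec_filter P s u v : P u -> P v -> prec (filter P s) u v = prec s u v.
Proof.
move=> Pu Pv; rewrite /prec; elim: s => //= x s IH.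
case: ifPn => Px /=; first by case: (x == u); case: (x == v).
have /negbTE-> : x != u by apply: contraNneq Px => ->.
have /negbTE-> : x != v by apply: contraNneq Px => ->.
by rewrite ltnS.
Qed.

Lemma prec_catl s t u v : u \in s -> v \in s -> prec (s ++ t) u v = prec s u v.
Proof. by move=> us vs; rewrite /prec !index_cat us vs. Qed.

Lemma prec_catr s t u v : u \notin s -> v \notin s ->
  prec (s ++ t) u v = prec t u v.
Proof.
by move=> /negbTE us /negbTE vs; rewrite /prec !index_cat us vs ltn_add2l.
Qed.

Lemma prec_catlr s t u v : u \in s -> v \notin s -> prec (s ++ t) u v.
Proof.
move=> us /negbTE vs; rewrite /prec !index_cat us vs.
by apply: ltn_addr; rewrite index_mem.
Qed.

Lemma prec_catrl s t u v : u \notin s -> v \in s -> prec (s ++ t) u v = false.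
Proof.
move=> /negbTE us vs; rewrite /prec !index_cat us vs ltnNge.
by apply/negbF; rewrite ltnW // ltn_addr // index_mem.
Qed.

Lemma index_rev_uniq s u : uniq s -> u \in s ->
  index u (rev s) = size s - (index u s).+1.
Proof.
move=> us uu; have hi : index u s < size s by rewrite index_mem.
have -> : index u (rev s) = index (nth u (rev s) (size s - (index u s).+1)) (rev s).
  rewrite nth_rev; last by lia.
  by rewrite (_ : size s - _.+1 = index u s) ?nth_index //; lia.
by rewrite index_uniq ?size_rev ?rev_uniq //; lia.
Qed.

Lemma prec_rev s u v : uniq s -> u \in s -> v \in s ->
  prec (rev s) u v = prec s v u.
Proof.
move=> us uu vv; rewrite /prec !index_rev_uniq //.
by move: uu vv; rewrite -!index_mem; lia.
Qed.

Lemma consec_rev s u v : uniq s -> u \in s -> v \in s ->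
  consec (rev s) u v = consec s u v.
Proof.
move=> us uu vv; rewrite /consec !index_rev_uniq //.
by move: uu vv; rewrite -!index_mem; lia.
Qed.

(** A duplicate-free list is sorted for its own order, and a list sorted for a strict order is
    determined by its elements. *)
Lemma prec_ext s t : uniq s -> uniq t -> s =i t ->
  {in s &, forall u v, prec s u v = prec t u v} -> s = t.
Proof.
move=> us ut st h.
have sor r : uniq r -> sorted (prec r) r.
  case: r => // x r ur; apply/(sortedP x) => i hi.
  by rewrite /prec !index_uniq // ltnW.
apply: (@irr_sorted_eq _ (prec s)) => //.
- by move=> x y z; apply: ltn_trans.
- by move=> x; rewrite /prec ltnn.
- exact: sor.
- rewrite (eq_in_sorted (P := mem s) (e' := prec t)) ?sor //.
  by apply/allP => x; rewrite -st.
Qed.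

(** Adjacency is expressed by the order alone, which survives filtering, whereas indices do not. *)
Lemma succ_prec s u v : uniq s -> u \in s -> v \in s ->
  (index v s == (index u s).+1) =
    prec s u v && ~~ has (fun w => prec s u w && prec s w v) s.
Proof.
move=> us uu vv; apply/eqP/andP => [e|[h /hasPn n]].
  split; first by rewrite /prec e.
  by apply/hasPn => w _; rewrite /prec e; lia.
apply/eqP; rewrite eqn_leq [_.+1 <= _]h andbT leqNgt; apply/negP => hlt.
have hi : (index u s).+1 < size s.
  by apply: (ltn_trans hlt); rewrite index_mem.
have /negP := n (nth u s (index u s).+1) (mem_nth _ hi); apply.
by rewrite /prec index_uniq // ltnSn.
Qed.

Lemma consec_prec s u v : uniq s -> u \in s -> v \in s ->
  consec s u v = [|| prec s u v && ~~ has (fun w => prec s u w && prec s w v) s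
    | prec s v u && ~~ has (fun w => prec s v w && prec s w u) s].
Proof. by move=> us uu vv; rewrite /consec !succ_prec. Qed.

(** The last hypothesis says that [P] selects an interval, so no element separating two selected
    ones is dropped. *)
Lemma consec_filter P s u v : uniq s -> u \in s -> v \in s -> P u -> P v ->
  (forall w w' x, w \in s -> w' \in s -> P w -> P w' -> x \in s ->
    prec s w x -> prec s x w' -> P x) ->
  consec (filter P s) u v = consec s u v.
Proof.
move=> us uu vv Pu Pv int.
have h w w' : w \in s -> w' \in s -> P w -> P w' ->
    has (fun x => prec (filter P s) w x && prec (filter P s) x w') (filter P s)
    = has (fun x => prec s w x && prec s x w') s.
  move=> ws ws' Pw Pw'; apply/hasP/hasP => -[x].
    by rewrite mem_filter => /andP[Px xs]; rewrite !prec_filter //; exists x.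
  move=> xs /andP[h1 h2]; have Px := int w w' x ws ws' Pw Pw' xs h1 h2.
  by exists x; rewrite ?mem_filter ?Px ?prec_filter // h1.
by rewrite !consec_prec ?filter_uniq ?mem_filter ?Pu ?Pv // !h // !prec_filter.
Qed.

(** Dropping elements cannot create a separator; hence only one implication, but for arbitrary
    [P]. *)
Lemma consec_filterW P s u v : uniq s -> u \in s -> v \in s -> P u -> P v ->
  consec s u v -> consec (filter P s) u v.
Proof.
move=> us uu vv Pu Pv; rewrite !consec_prec ?filter_uniq ?mem_filter ?Pu ?Pv //.
have h w w' : P w -> P w' ->
    has (fun x => prec (filter P s) w x && prec (filter P s) x w') (filter P s)
    -> has (fun x => prec s w x && prec s x w') s.
  move=> Pw Pw' /hasP[x]; rewrite mem_filter => /andP[Px xs].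
  by rewrite !prec_filter // => hx; apply/hasP; exists x.
rewrite !prec_filter //.
by case/orP=> /andP[-> /(contra (h _ _ _ _))->] //; rewrite orbT.
Qed.

Lemma consec_catl s t u v : u \in s -> v \in s ->
  consec (s ++ t) u v = consec s u v.
Proof. by move=> us vs; rewrite /consec !index_cat us vs. Qed.

Lemma consec_catr s t u v : u \notin s -> v \notin s ->
  consec (s ++ t) u v = consec t u v.
Proof.
by move=> /negbTE us /negbTE vs; rewrite /consec !index_cat us vs -!addnS !eqn_add2l.
Qed.

Lemma consec_cons x s u v : u != x -> v != x ->
  consec (x :: s) u v = consec s u v.
Proof. by move=> ux vx; rewrite -cat1s consec_catr // inE. Qed.

Lemma consec_head x y s w : x != y -> consec [:: x, y & s] x w = (w == y).
Proof.
move=> /negbTE nxy; rewrite /consec /= eqxx.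
case: (eqVneq x w) => [<-|_]; first by rewrite nxy.
by rewrite orbF eqSS (eq_sym w); case: (y == w).
Qed.

(** The head has a single neighbour, so the second elements coincide and the tails can be compared
    in turn. *)
Lemma consec_same_head x s t : uniq (x :: s) -> uniq (x :: t) -> s =i t ->
  {in x :: s &, forall u v, consec (x :: s) u v = consec (x :: t) u v} -> s = t.
Proof.
elim: s x t => [|y s IH] x t us ut st h.
  by case: t st {ut h} => // z t /(_ z); rewrite mem_head.
have nxy : x != y by case/and3P: us; rewrite inE negb_or => /andP[].
case: t ut st h => [|z t] ut st h.
  by have := st y; rewrite mem_head.
have nxz : x != z by case/and3P: ut; rewrite inE negb_or => /andP[].
have eyz : y = z.
  have := h x y (mem_head _ _); rewrite inE mem_head orbT => /(_ isT).
  by rewrite !consec_head // eqxx => /esym/eqP.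
subst z; congr (_ :: _); apply: (IH y).
- by case/andP: us.
- by case/andP: ut.
- move=> w; have := st w; rewrite !inE; case: eqP => //= -> _.
  by case/and3P: us ut => _ /negbTE-> _ /and3P[_ /negbTE->].
- move=> u v uu vv; have := h u v; rewrite [u \in _]inE uu [v \in _]inE vv !orbT.
  have nx w : w \in y :: s -> w != x.
    by move=> wy; apply: contraTneq wy => ->; case/andP: us.
  by rewrite !(@consec_cons x) ?nx //; apply.
Qed.

(** A path has only two listings: the head [x] of [s] has at most one neighbour, so it must be an
    end of [t]. *)
Lemma consec_unique s t : uniq s -> uniq t -> s =i t ->
  {in s &, forall u v, consec s u v = consec t u v} -> t = s \/ t = rev s.
Proof.
case: s => [|x s] us ut st h.
  by left; case: t st {ut h} => // z t /(_ z); rewrite mem_head.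
have xt : x \in t by rewrite -st mem_head.
case/splitPr: xt ut st h => t1 t2.
case: t1 => [|a t1] /= ut st h.
  left; congr (_ :: _); apply/esym/(@consec_same_head x) => // w.
  have := st w; rewrite !inE; case: eqP => //= -> _.
  by case/andP: us ut => /negbTE-> _ /andP[/negbTE->].
case: t2 ut st h => [|b t2] ut st h.
  (* [x] is the last element of [t], so the reverse of [t] has the same head as [s]. *)
  right; have e : a :: t1 ++ [:: x] = rev (x :: rev (a :: t1)).
    by rewrite rev_cons revK -cats1.
  rewrite e; congr rev; congr (_ :: _); apply/esym.
  have ut' : uniq (x :: rev (a :: t1)) by rewrite -rev_uniq -e.
  apply: (@consec_same_head x) => //.
    move=> w; have := st w; rewrite e mem_rev !inE; case: eqP => //= -> _.
    by case/andP: us ut' => /negbTE-> _ /andP[/negbTE->].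
  move=> u v uu vv; rewrite h // e consec_rev // -mem_rev -e -st //.
(* [x] is inside [t], so it has two distinct neighbours [c] and [b] there, but in [s] it has only
   one. *)
have [c [t1' et]] : exists c t1', a :: t1 = rcons t1' c.
  by exists (last a t1), (belast a t1); rewrite lastI.
have et' : a :: t1 ++ [:: x, b & t2] = t1' ++ [:: c, x, b & t2].
  by rewrite -cat_cons et cat_rcons.
have {}ut : uniq (t1' ++ [:: c, x, b & t2]) by rewrite -et'.
rewrite et' in st h.
have [nc nx [ncx ncb nxb]] : [/\ c \notin t1', x \notin t1' & [/\ c != x, c != b & x != b]].
  move: ut; rewrite cat_uniq /= !inE !negb_or.
  by case/and3P=> _ /and4P[-> -> _ _] /and3P[/and3P[-> -> _] /andP[-> _] _].
have nb : b \notin t1'.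
  by move: ut; rewrite cat_uniq /= !negb_or => /and3P[_ /and4P[_ _ ->]].
have cx : consec (x :: s) x c.
  rewrite h ?mem_head ?st ?mem_cat ?inE ?eqxx ?orbT //.
  by rewrite consec_catr // consecC consec_head // eqxx.
have bx : consec (x :: s) x b.
  rewrite h ?mem_head ?st ?mem_cat ?inE ?eqxx ?orbT //.
  by rewrite consec_catr // consec_cons // 1?eq_sym // consec_head // eqxx.
case: s us cx bx st {h} => [|y s] us cx bx st.
  by have := st c; rewrite mem_cat !inE (negbTE ncx) eqxx orbT.
have nxy : x != y by case/and3P: us; rewrite inE negb_or => /andP[].
rewrite consec_head // in cx; rewrite consec_head // in bx.
by case/eqP: ncb; rewrite (eqP cx) (eqP bx).
Qed.
End Prec.

(** * Permutations in which every edge joins neighbours *)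

(** For a disjoint union of paths these are the MinLAs. The condition is stated edge by edge, so it
    passes from the final graph to all earlier ones. *)
Definition tight (V : finType) (es : seq (V * V)) (p : arrangement V) : bool :=
  all (fun e => consec (val p) e.1 e.2) es.

Section Tight.
Context {V : finType}.
Implicit Types (es h : seq (V * V)) (p q : arrangement V) (x y u v w : V).

Lemma graph_sym es : symmetric (graph es).
Proof. by move=> x y; rewrite /graph orbC. Qed.

Lemma graph_connect_sym es : connect_sym (graph es).
Proof. exact/sym_connect_sym/graph_sym. Qed.

Lemma mem_component_self es x : x \in component (graph es) x.
Proof. by rewrite inE connect0. Qed.

Lemma component_eq es x y : y \in component (graph es) x ->
  component (graph es) y = component (graph es) x.
Proof.
rewrite inE => xy; apply/setP=> u; rewrite !inE.
by rewrite (same_connect (graph_connect_sym es) xy).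
Qed.

Lemma mem_componentC es x y :
  (y \in component (graph es) x) = (x \in component (graph es) y).
Proof. by rewrite !inE graph_connect_sym. Qed.

Lemma component_disjoint es x y u :
  component (graph es) x != component (graph es) y ->
  u \in component (graph es) x -> u \notin component (graph es) y.
Proof.
move=> nxy ux; apply: contraNN nxy => uy.
by rewrite -(component_eq ux) -(component_eq uy).
Qed.

Lemma edge_component es x y a : graph es x y ->
  (x \in component (graph es) a) = (y \in component (graph es) a).
Proof.
by move=> xy; rewrite !inE (same_connect_r (graph_connect_sym es) (connect1 xy)).
Qed.

Lemma tight_graph es p x y : tight es p -> graph es x y -> consec (val p) x y.
Proof.
by move=> /allP tp /orP[] /tp //=; rewrite consecC.
Qed.

Lemma tight_sub es h p : {subset h <= es} -> tight es p -> tight h p.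
Proof. by move=> sub /allP tp; apply/allP => e /sub /tp. Qed.

(** If [u] and its right neighbour [w] are not adjacent in the graph, no edge crosses the gap
    between them. The positions up to [u] are then closed under the graph, although [u] is connected
    to [v] beyond the gap. *)
Lemma tight_next es p u v w : tight es p -> connect (graph es) u v ->
  prec (val p) u v -> pos p w = (pos p u).+1 -> graph es u w.
Proof.
move=> tp uv puv ew; case: (boolP (graph es u w)) => // nuw; exfalso.
have sub a b : graph es a b -> pos p a <= pos p u -> pos p b <= pos p u.
  move=> ab au; rewrite leqNgt; apply/negP => ub.
  have cab := tight_graph tp ab.
  have ea : a = u.
    by apply: (@pos_inj _ p); move: cab; rewrite /consec -!/(pos p _); lia.
  have eb : b = w.
    by apply: (@pos_inj _ p); move: cab; rewrite /consec -!/(pos p _) ea; lia.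
  by case/negP: nuw; rewrite -ea -eb.
have cl : closed (graph es) [pred a | pos p a <= pos p u].
  move=> a b ab; rewrite !inE; apply/idP/idP; apply: sub => //.
  by rewrite graph_sym.
have := closed_connect cl uv; rewrite !inE leqnn => /esym.
by move: puv; rewrite /prec -!/(pos p _); lia.
Qed.

(** Components are contiguous: walking right from [u], each step is an edge by [tight_next] as long
    as [v] still lies ahead. *)
Lemma component_interval es p a u v x : tight es p ->
  u \in component (graph es) a -> v \in component (graph es) a ->
  prec (val p) u x -> prec (val p) x v -> x \in component (graph es) a.
Proof.
move=> tp ua va; rewrite /prec -!/(pos p _) => ux xv.
have uv : connect (graph es) u v by move: va; rewrite -(component_eq ua) inE.
suff H k y : pos p y = pos p u + k -> pos p y < pos p v -> connect (graph es) u y.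
  rewrite -(component_eq ua) inE; apply: (H (pos p x - pos p u)) => //; lia.
elim: k y => [|k IH] y ey yv.
  by rewrite addn0 in ey; rewrite (pos_inj ey).
have hk : pos p u + k < size (val p).
  have := pos_lt p v; rewrite cardE -(perm_size (arrangement_perm p)).
  by apply: ltn_trans; move: ey yv; clear; lia.
pose z := nth u (val p) (pos p u + k).
have ez : pos p z = pos p u + k by rewrite /pos index_uniq ?arrangement_uniq.
have uz : connect (graph es) u z by apply: IH => //; move: ey yv; clear -ez; lia.
apply: (connect_trans uz); apply: connect1.
apply: (@tight_next es p z v) => //.
- by apply: connect_trans uv; rewrite (graph_connect_sym es z u).
- by rewrite /prec -!/(pos p _) ez; move: ey yv; clear; lia.
- by rewrite ez ey addnS.
Qed.

Lemma prec_neq p u v : u != v -> prec (val p) u v = ~~ prec (val p) v u.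
Proof. by apply: prec_antisym; apply: mem_arrangement. Qed.

(** A contiguous component lies entirely on one side of each node outside it. *)
Lemma prec_component es p a u u' v : tight es p ->
  u \in component (graph es) a -> u' \in component (graph es) a ->
  v \notin component (graph es) a -> prec (val p) u v = prec (val p) u' v.
Proof.
move=> tp ua ua' va.
have n w : w \in component (graph es) a -> w != v.
  by move=> wa; apply: contraNneq va => <-.
have H w w' : w \in component (graph es) a -> w' \in component (graph es) a ->
    prec (val p) w v -> prec (val p) w' v.
  move=> wa wa' wv; rewrite prec_neq ?n //; apply: contraNN va => vw'.
  exact: (component_interval tp wa wa').
by apply/idP/idP; apply: H.
Qed.

Lemma tight_edge es p a u v : tight es p ->
  u \in component (graph es) a -> v \in component (graph es) a ->
  graph es u v = consec (val p) u v.
Proof.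
move=> tp ua va; apply/idP/idP; first exact: tight_graph.
have H w w' : w \in component (graph es) a -> w' \in component (graph es) a ->
    pos p w' = (pos p w).+1 -> graph es w w'.
  move=> wa wa' e; apply: (@tight_next es p w w') => //.
    by move: wa'; rewrite -(component_eq wa) inE.
  by rewrite /prec -!/(pos p _) e.
by case/orP=> /eqP e; [|rewrite graph_sym]; apply: H.
Qed.

Lemma mem_block es p a u : (u \in block es p a) = (u \in component (graph es) a).
Proof. by rewrite mem_filter mem_arrangement andbT. Qed.

Lemma block_uniq es p a : uniq (block es p a).
Proof. by rewrite filter_uniq ?arrangement_uniq. Qed.

Lemma size_block es p a : size (block es p a) = #|component (graph es) a|.
Proof.
rewrite -(card_uniqP (block_uniq es p a)); apply: eq_card => u.
exact: mem_block.
Qed.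

Lemma consec_block es p a u v : tight es p ->
  u \in component (graph es) a -> v \in component (graph es) a ->
  consec (block es p a) u v = consec (val p) u v.
Proof.
move=> tp ua va; apply: consec_filter; rewrite ?arrangement_uniq ?mem_arrangement //.
by move=> w w' x _ _ wa wa' _; apply: (component_interval tp).
Qed.

Lemma path_order_block es p a : tight es p ->
  path_order (graph es) (component (graph es) a) (block es p a).
Proof.
move=> tp; apply/and3P; split; first exact: block_uniq.
  by apply/forallP => u; rewrite mem_block.
apply/forall_inP => u ua; apply/forall_inP => v va.
by rewrite -/(consec (block es p a) u v) consec_block // (tight_edge tp ua va).
Qed.

Lemma path_orderP (G : rel V) (C : {set V}) (s : seq V) :
  path_order G C s -> [/\ uniq s, s =i C & {in C &, G =2 consec s}].
Proof.
case/and3P=> us /forallP sC /forall_inP GC; split=> // u.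
  exact/eqP.
by move=> v uC vC; have /forall_inP/(_ v vC)/eqP := GC u uC.
Qed.

Lemma path_order_unique (G : rel V) (C : {set V}) (s t : seq V) :
  path_order G C s -> path_order G C t -> t = s \/ t = rev s.
Proof.
move=> /path_orderP[us sC Gs] /path_orderP[ut tC Gt].
apply: consec_unique => // [u|u v]; first by rewrite sC tC.
by rewrite !sC => uC vC; rewrite -Gs ?Gt.
Qed.

Definition joined h (e : V * V) : {set V} :=
  component (graph h) e.1 :|: component (graph h) e.2.

Lemma graph_rcons h e x y : graph (rcons h e) x y =
  [|| graph h x y, (x == e.1) && (y == e.2) | (x == e.2) && (y == e.1)].
Proof.
rewrite /graph !mem_rcons !inE; case: e => a b; rewrite !xpair_eqE /=.
rewrite [(y == a) && _]andbC.
by do 4 case: (_ == _); case: (_ \in _); case: (_ \in _).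
Qed.

Lemma component_rcons h e u : component (graph (rcons h e)) u =
  if u \in joined h e then joined h e else component (graph h) u.
Proof.
have sub a b : connect (graph h) a b -> connect (graph (rcons h e)) a b.
  apply: connect_sub => x y xy; apply: connect1; rewrite graph_rcons xy //.
have ee : connect (graph (rcons h e)) e.1 e.2.
  by apply: connect1; rewrite graph_rcons !eqxx orbT.
have m1 : e.1 \in joined h e by rewrite in_setU mem_component_self.
have m2 : e.2 \in joined h e by rewrite in_setU mem_component_self orbT.
have closed_mem (C : {set V}) a b :
    (forall x y, graph (rcons h e) x y -> (x \in C) = (y \in C)) ->
    connect (graph (rcons h e)) a b -> (a \in C) = (b \in C).
  by move=> cl; apply: (closed_connect (a := mem C)).
case: ifPn => uS; apply/eqP; rewrite eqEsubset; apply/andP; split;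
    apply/subsetP => v.
- rewrite inE => uv; rewrite -(closed_mem _ u) // => a b.
  rewrite graph_rcons => /or3P[ab||].
  + by rewrite !in_setU !(edge_component _ ab).
  + by case/andP=> /eqP-> /eqP->; rewrite m1 m2.
  + by case/andP=> /eqP-> /eqP->; rewrite m1 m2.
- have toe w : w \in joined h e -> connect (graph (rcons h e)) e.1 w.
    rewrite !inE => /orP[/sub //|/sub]; exact: connect_trans.
  move=> vS; rewrite inE; apply: connect_trans (toe v vS).
  by rewrite graph_connect_sym toe.
- have [n1 n2] : e.1 \notin component (graph h) u /\ e.2 \notin component (graph h) u.
    by move: uS; rewrite in_setU negb_or !(mem_componentC _ _ u) => /andP[].
  rewrite inE => uv; rewrite -(closed_mem _ u) ?mem_component_self // => a b.
  rewrite graph_rcons => /or3P[ab||].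
  + exact: edge_component.
  + by case/andP=> /eqP-> /eqP->; rewrite (negbTE n1) (negbTE n2).
  + by case/andP=> /eqP-> /eqP->; rewrite (negbTE n1) (negbTE n2).
- by rewrite !inE => /sub.
Qed.
End Tight.

Definition inverted (V : finType) (p q : arrangement V) (u v : V) : bool :=
  (u != v) && (prec (val p) u v (+) prec (val q) u v).

Lemma invertedC (V : finType) (p q : arrangement V) (u v : V) :
  inverted p q u v = inverted p q v u.
Proof.
rewrite /inverted eq_sym; case: eqVneq => //= nuv.
rewrite (@prec_neq _ p) 1?eq_sym // (@prec_neq _ q) 1?eq_sym //.
by case: (prec _ _ _); case: (prec _ _ _).
Qed.

Lemma inverted_trans (V : finType) (p q r : arrangement V) (u v : V) :
  inverted p q u v <= inverted p r u v + inverted r q u v.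
Proof.
rewrite /inverted; case: (u == v) => //=.
by do 3 case: (prec _ _ _).
Qed.

(** * One update of Rand, compared with a fixed permutation [q] tight for the new graph *)

Section Step.
Context {V : finType} (hist : seq (V * V)) (e : V * V) (pi q : arrangement V).
Context (nXZ : component (graph hist) e.1 != component (graph hist) e.2).
Context (tpi : tight hist pi) (tq : tight (rcons hist e) q).

Local Notation l := (left_node pi e).
Local Notation r := (right_node pi e).
Local Notation L := (component (graph hist) l).
Local Notation R := (component (graph hist) r).
Local Notation S := (joined hist e).
Local Notation lb := (left_block hist pi e).
Local Notation rb := (right_block hist pi e).
Local Notation upd := (update hist pi e).
Local Notation rearr := (rearranged hist pi e).
Local Notation tgt := (target hist pi e).

Lemma tight_hist : tight hist q.
Proof. by apply: tight_sub tq => x; rewrite mem_rcons inE orbC => ->. Qed.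

Lemma joinedE u : (u \in S) = (u \in L) || (u \in R).
Proof.
by rewrite in_setU /left_node /right_node; case: ifP => _ //; rewrite orbC.
Qed.

Lemma left_right_disjoint u : u \in L -> u \notin R.
Proof.
rewrite /left_node /right_node; case: ifP => _; apply: component_disjoint => //.
by rewrite eq_sym.
Qed.

Lemma outsideE v : outside hist e v = (v \notin S).
Proof. by rewrite /outside in_setU negb_or. Qed.

Lemma left_lt_right : pos pi l < pos pi r.
Proof.
have /eqP nxz : pos pi e.1 != pos pi e.2.
  by apply: contraNneq nXZ => /pos_inj ->.
by rewrite /left_node /right_node; case: ifP; lia.
Qed.

(** [left_node] and [right_node] only compare the two ends of the new edge; contiguity of both
    components extends the comparison to all their nodes. *)
Lemma prec_left_right u v : u \in L -> v \in R -> prec (val pi) u v.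
Proof.
move=> uL vR.
rewrite (@prec_component _ hist pi l u l v) ?mem_component_self //; last first.
  by apply/negP => /left_right_disjoint; rewrite vR.
have nlv : l != v.
  by apply: contraNneq (left_right_disjoint (mem_component_self hist l)) => ->.
rewrite prec_neq // (@prec_component _ hist pi r v r l) ?mem_component_self //;
  last exact/left_right_disjoint/mem_component_self.
by rewrite /prec -leqNgt ltnW // left_lt_right.
Qed.

Lemma component_joined u : u \in S -> component (graph (rcons hist e)) u = S.
Proof. by move=> uS; rewrite component_rcons uS. Qed.

Lemma node_joined : [/\ l \in S, r \in S, e.1 \in S & e.2 \in S].
Proof. 
by split; [rewrite joinedE|rewrite joinedE|rewrite in_setU|rewrite in_setU];
  rewrite mem_component_self ?orbT. Qed.

Lemma mem_rearranged c u : (u \in rearr c) = (u \in S).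
Proof.
rewrite joinedE /rearranged.
have m b (s : seq V) : (u \in if b then rev s else s) = (u \in s).
  by case: b; rewrite ?mem_rev.
by case: (c.1.2); rewrite mem_cat !m !mem_block // orbC.
Qed.

Lemma rearranged_uniq c : uniq (rearr c).
Proof.
rewrite /rearranged.
have m b (s : seq V) : (if b then rev s else s) =i s.
  by case: b => // u; rewrite ?mem_rev.
have n b (s : seq V) : uniq (if b then rev s else s) = uniq s.
  by case: b; rewrite ?rev_uniq.
suff H : uniq ((if c.1.1 then rev lb else lb) ++ (if c.2 then rev rb else rb)).
  by case: (c.1.2); rewrite // uniq_catC.
rewrite cat_uniq !n !block_uniq andbT /=.
apply/hasPn => u; rewrite !m /= !mem_block => uR.
by apply/negP => /left_right_disjoint; rewrite uR.
Qed.

Lemma rearranged_target b : rearr (tgt (~~ b)) = rev (rearr (tgt b)).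
Proof.
suff H c : rearr (~~ c.1.1, ~~ c.1.2, ~~ c.2) = rev (rearr c).
  by rewrite /target; case: b; rewrite /= H ?revK.
rewrite /rearranged /=; case: c => [[[] []] []] /=; by rewrite rev_cat ?revK.
Qed.

Lemma block_reorient x : block hist q x = block hist pi x \/
  block hist q x = rev (block hist pi x).
Proof. by apply: path_order_unique; apply: path_order_block => //; exact: tight_hist. Qed.

Lemma block_joined : block (rcons hist e) q e.1 = [seq v <- val q | v \in S].
Proof.
by have [_ _ h _] := node_joined; rewrite /block component_joined.
Qed.

(** In [q] both old components are still contiguous, and each is listed as in [pi] or in reverse, so
    three binary choices describe [q] on the joined component. *)
Lemma filter_joined_rearranged : exists c, [seq v <- val q | v \in S] = rearr c.
Proof.
have tq' := tight_hist.
(* Reverse a block iff [q] lists it differently from [pi]; swap the blocks iff [q] puts the right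
   one first. *)
exists (block hist q l != lb, prec (val q) r l, block hist q r != rb).
have eb x : block hist q x = if block hist q x != block hist pi x
    then rev (block hist pi x) else block hist pi x.
  by case: eqP => //= n; case: (block_reorient x).
rewrite /rearranged /= -!eb; apply: prec_ext.
- by rewrite filter_uniq ?arrangement_uniq.
- suff H : uniq (block hist q l ++ block hist q r).
    by case: (prec _ r l); rewrite // uniq_catC.
  rewrite cat_uniq !block_uniq andbT /=.
  apply/hasPn => u; rewrite /= !mem_block => uR.
  by apply/negP => /left_right_disjoint; rewrite uR.
- move=> u; rewrite mem_filter mem_arrangement andbT joinedE.
  by case: (prec _ r l); rewrite mem_cat !mem_block // orbC.
have rl u v : u \in L -> v \in R -> prec (val q) v u = prec (val q) r l.
  move=> uL vR; have nv w : w \in R -> w \notin L.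
    by move=> wR; apply/negP => /left_right_disjoint; rewrite wR.
  rewrite (@prec_component _ hist q r v r u) ?mem_component_self ?left_right_disjoint //.
  have n w : w \in L -> w != r.
    by move=> wL; apply: contraNneq (left_right_disjoint wL) => ->; apply: mem_component_self.
  rewrite !(@prec_neq _ q r) 1?eq_sym ?n ?mem_component_self //.
  by rewrite (@prec_component _ hist q l u l r) ?mem_component_self ?nv ?mem_component_self.
have lr u v : u \in L -> v \in R -> prec (val q) u v = ~~ prec (val q) r l.
  move=> uL vR; rewrite prec_neq ?(rl u v) //.
  by apply: contraNneq (left_right_disjoint uL) => ->.
move=> u v; rewrite !mem_filter !mem_arrangement !andbT => uS vS.
rewrite prec_filter //.
have nL w : w \in R -> w \notin L.
  by move=> wR; apply/negP => /left_right_disjoint; rewrite wR.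
move: uS vS; rewrite !joinedE.
case: ifP => hrl /orP[] uX /orP[] vX.
- by rewrite prec_catr ?mem_block ?left_right_disjoint // prec_filter.
- by rewrite (lr u v uX vX) hrl prec_catrl ?mem_block ?left_right_disjoint.
- by rewrite (rl v u vX uX) hrl prec_catlr ?mem_block ?left_right_disjoint.
- by rewrite prec_catl ?mem_block // prec_filter.
- by rewrite prec_catl ?mem_block // prec_filter.
- by rewrite (lr u v uX vX) hrl prec_catlr ?mem_block ?nL.
- by rewrite (rl v u vX uX) hrl prec_catrl ?mem_block ?nL.
- by rewrite prec_catr ?mem_block ?nL // prec_filter.
Qed.

(** The combination read off from [q] is an order along the new path, so the [pick] in
    [base_combination] succeeds. Such an order being unique up to reversal, [q] agrees with one of
    the two targets. *)
Lemma target_filter_joined : exists b, rearr (tgt b) = [seq v <- val q | v \in S].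
Proof.
have [c ec] := filter_joined_rearranged.
have pq := path_order_block e.1 tq; rewrite block_joined ec in pq.
have pb : path_order (graph (rcons hist e)) (component (graph (rcons hist e)) e.1)
    (rearr (tgt true)).
  rewrite /target /base_combination; case: pickP => //= /(_ c).
  by rewrite pq.
rewrite ec; case: (path_order_unique pb pq) => ->; first by exists true.
by exists false; rewrite -(rearranged_target true).
Qed.

Lemma val_update w : val (upd w) = update_listing hist pi e w.
Proof. by rewrite /update insubdK //; apply: update_listing_perm. Qed.

Lemma mem_before v : (v \in before_blocks hist pi e) = (v \notin S) && (pos pi v < pos pi l).
Proof. by rewrite mem_filter mem_arrangement andbT outsideE. Qed.

Lemma mem_between v : (v \in between_blocks hist pi e) =
  (v \notin S) && (pos pi l < pos pi v < pos pi r).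
Proof. by rewrite mem_filter mem_arrangement andbT outsideE. Qed.

Lemma mem_after v : (v \in after_blocks hist pi e) = (v \notin S) && (pos pi r < pos pi v).
Proof. by rewrite mem_filter mem_arrangement andbT outsideE. Qed.

Lemma pos_outside v : v \notin S -> pos pi v != pos pi l /\ pos pi v != pos pi r.
Proof.
have [lS rS _ _] := node_joined => vS; split; apply: contraNneq vS => /pos_inj ->//.
Qed.

Lemma prec_update_joined w u v : u \in S -> v \in S ->
  prec (val (upd w)) u v = prec (rearr (tgt w.2)) u v.
Proof.
move=> uS vS; rewrite val_update /update_listing.
rewrite prec_catr ?mem_before ?uS ?vS //.
by case: w.1; rewrite -?catA;
  [rewrite prec_catr ?mem_between ?uS ?vS //|]; rewrite prec_catl ?mem_rearranged.
Qed.

(** When the left block moves ([w.1] true) it passes the nodes in between, which then precede the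
    joined block; otherwise they follow it. *)
Lemma prec_update_mixed w u v : u \in S -> v \notin S ->
  prec (val (upd w)) u v =
    if pos pi v < pos pi l then false
    else if pos pi r < pos pi v then true else ~~ w.1.
Proof.
move=> uS vS; rewrite val_update /update_listing.
have [nl nr] := pos_outside vS; have lr := left_lt_right.
case: (boolP (pos pi v < pos pi l)) => vl.
  by rewrite prec_catrl ?mem_before ?uS ?vS.
rewrite prec_catr ?mem_before ?uS ?vS //=.
case: (boolP (pos pi r < pos pi v)) => vr.
  rewrite prec_catlr //; first by case: w.1; rewrite mem_cat mem_rearranged uS ?orbT.
  have vb : v \notin between_blocks hist pi e.
    rewrite mem_between vS /=; apply/negP; move: vr; clear; lia.
  by case: w.1; rewrite mem_cat mem_rearranged (negbTE vS) (negbTE vb).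
have vb : v \in between_blocks hist pi e.
  rewrite mem_between vS /=; move: vl vr nl nr; clear; lia.
case: w.1; rewrite -?catA.
  by rewrite prec_catrl // mem_between uS.
by rewrite prec_catlr ?mem_rearranged.
Qed.

Lemma prec_update_outside w u v : u \notin S -> v \notin S ->
  prec (val (upd w)) u v = prec (val pi) u v.
Proof.
move=> uS vS; rewrite val_update.
have lr := left_lt_right.
(* Deleting the joined block leaves three pieces of [pi], still in the order of [pi]. *)
have e1 : [seq x <- update_listing hist pi e w | x \notin S] =
    before_blocks hist pi e ++ between_blocks hist pi e ++ after_blocks hist pi e.
  have f0 : [seq x <- rearr (tgt w.2) | x \notin S] = [::].
    rewrite (@eq_in_filter _ _ pred0) ?filter_pred0 // => x.
    by rewrite mem_rearranged => ->.
  have fid (s : seq V) : {in s, forall x, x \notin S} -> [seq x <- s | x \notin S] = s.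
    by move=> h; apply/all_filterP/allP.
  rewrite /update_listing !filter_cat; congr (_ ++ _).
    by apply: fid => x; rewrite mem_before => /andP[].
  congr (_ ++ _); last by apply: fid => x; rewrite mem_after => /andP[].
  case: w.1; rewrite filter_cat f0 ?cats0; apply: fid => x;
    by rewrite mem_between => /andP[].
rewrite -(@prec_filter _ (fun x => x \notin S)) // e1.
have [ul ur] := pos_outside uS; have [vl vr] := pos_outside vS.
have ltE x y : prec (val pi) x y = (pos pi x < pos pi y) by [].
have fE P : outside hist e u && P u -> outside hist e v && P v ->
    prec [seq x <- val pi | outside hist e x && P x] u v = prec (val pi) u v.
  by move=> hu hv; rewrite prec_filter.
case: (ltnP (pos pi u) (pos pi l)) => u1; case: (ltnP (pos pi v) (pos pi l)) => v1.
- by rewrite prec_catl ?mem_before ?uS ?vS // fE // outsideE ?uS ?vS.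
- rewrite prec_catlr ?mem_before ?uS ?vS -?leqNgt //= ltE.
  by move: u1 v1; clear; lia.
- rewrite prec_catrl ?mem_before ?uS ?vS -?leqNgt //= ltE.
  by move: u1 v1; clear; lia.
rewrite prec_catr ?mem_before ?uS ?vS -?leqNgt //=.
have {}u1 : pos pi l < pos pi u by rewrite ltn_neqAle eq_sym ul.
have {}v1 : pos pi l < pos pi v by rewrite ltn_neqAle eq_sym vl.
case: (ltnP (pos pi u) (pos pi r)) => u2; case: (ltnP (pos pi v) (pos pi r)) => v2.
- by rewrite prec_catl ?mem_between ?uS ?vS ?u1 ?v1 // fE // outsideE ?uS ?vS ?u1 ?v1.
- rewrite prec_catlr ?mem_between ?uS ?vS ?u1 ?v1 -?leqNgt //= ltE.
  by move: u2 v2; clear; lia.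
- rewrite prec_catrl ?mem_between ?uS ?vS ?u1 ?v1 -?leqNgt //= ltE.
  by move: u2 v2; clear; lia.
rewrite prec_catr ?mem_between ?uS ?vS ?u1 ?v1 -?leqNgt //=.
have {}u2 : pos pi r < pos pi u by rewrite ltn_neqAle eq_sym ur.
have {}v2 : pos pi r < pos pi v by rewrite ltn_neqAle eq_sym vr.
by rewrite fE // outsideE ?uS ?vS.
Qed.

Lemma prec_rearranged_left c u v : u != v -> u \in L -> v \in L ->
  prec (rearr c) u v = prec (val pi) u v (+) c.1.1.
Proof.
move=> nuv uL vL; have [uR vR] := (left_right_disjoint uL, left_right_disjoint vL).
have m b (s : seq V) x : (x \in if b then rev s else s) = (x \in s).
  by case: b; rewrite ?mem_rev.
have -> : prec (rearr c) u v = prec (if c.1.1 then rev lb else lb) u v.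
  by rewrite /rearranged; case: (c.1.2); [apply: prec_catr|apply: prec_catl];
    rewrite m mem_block.
case: (c.1.1); rewrite ?prec_rev ?block_uniq ?mem_block // prec_filter //.
  by rewrite addbT; apply: prec_neq; rewrite eq_sym.
by rewrite addbF.
Qed.

Lemma prec_rearranged_right c u v : u != v -> u \in R -> v \in R ->
  prec (rearr c) u v = prec (val pi) u v (+) c.2.
Proof.
have nL w : w \in R -> w \notin L.
  by move=> wR; apply/negP => /left_right_disjoint; rewrite wR.
move=> nuv uR vR; have [uL vL] := (nL _ uR, nL _ vR).
have m b (s : seq V) x : (x \in if b then rev s else s) = (x \in s).
  by case: b; rewrite ?mem_rev.
have -> : prec (rearr c) u v = prec (if c.2 then rev rb else rb) u v.
  by rewrite /rearranged; case: (c.1.2); [apply: prec_catl|apply: prec_catr];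
    rewrite m mem_block.
case: (c.2); rewrite ?prec_rev ?block_uniq ?mem_block // prec_filter //.
  by rewrite addbT; apply: prec_neq; rewrite eq_sym.
by rewrite addbF.
Qed.

Lemma prec_rearranged_mixed c u v : u \in L -> v \in R ->
  prec (rearr c) u v = ~~ c.1.2.
Proof.
move=> uL vR; have uR := left_right_disjoint uL.
have vL : v \notin L by apply/negP => /left_right_disjoint; rewrite vR.
have m b (s : seq V) x : (x \in if b then rev s else s) = (x \in s).
  by case: b; rewrite ?mem_rev.
rewrite /rearranged; case: (c.1.2); [apply: prec_catrl|apply: prec_catlr];
  by rewrite m mem_block.
Qed.

Lemma prec_joined u v w : u \in S -> v \in S -> w \notin S ->
  prec (val q) u w = prec (val q) v w.
Proof.
have [_ _ h _] := node_joined.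
by rewrite -(component_joined h); apply: prec_component.
Qed.

Section Target.
Context (b : bool) (eb : rearr (tgt b) = [seq v <- val q | v \in S]).

Lemma prec_target u v : u \in S -> v \in S ->
  prec (val q) u v = prec (rearr (tgt b)) u v.
Proof. by move=> uS vS; rewrite eb prec_filter. Qed.

(** Target [b] turns the order of [pi] on the joined component into that of [q]. Hence the
    operations it performs flip exactly the disagreeing groups of pairs, here those inside the left
    block. *)
Lemma inverted_left u v : u != v -> u \in L -> v \in L -> inverted pi q u v = (tgt b).1.1.
Proof.
move=> nuv uL vL; rewrite /inverted nuv prec_target ?joinedE ?uL ?vL //.
by rewrite prec_rearranged_left // addKb.
Qed.

Lemma inverted_right u v : u != v -> u \in R -> v \in R -> inverted pi q u v = (tgt b).2.
Proof.
move=> nuv uR vR; rewrite /inverted nuv prec_target ?joinedE ?uR ?vR ?orbT //.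
by rewrite prec_rearranged_right // addKb.
Qed.

Lemma inverted_left_right u v : u \in L -> v \in R -> inverted pi q u v = (tgt b).1.2.
Proof.
move=> uL vR; rewrite /inverted prec_target ?joinedE ?uL ?vR ?orbT //.
have -> : u != v by apply: contraNneq (left_right_disjoint uL) => ->.
by rewrite prec_rearranged_mixed // prec_left_right //; case: (tgt b).1.2.
Qed.

(** All or nothing: the target other than [b] is the exact reverse of the order of [q]. *)
Lemma inverted_update_joined w u v : u != v -> u \in S -> v \in S ->
  inverted (upd w) q u v = (w.2 != b).
Proof.
move=> nuv uS vS; rewrite /inverted nuv prec_target // prec_update_joined //.
have [->|nb] := eqVneq w.2 b; first by rewrite addbb.
have -> : w.2 = ~~ b by case: w.2 b nb => -[].
rewrite rearranged_target prec_rev ?rearranged_uniq ?mem_rearranged //.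
rewrite (@prec_antisym _ _ u v) ?mem_rearranged //.
by case: (prec _ v u).
Qed.

(** Invariant of the run. Both targets list the new path, and an old edge outside it stays inside
    one of the pieces that the update moves as a whole. *)
Lemma update_tight w : tight (rcons hist e) (upd w).
Proof.
suff H (u v : V) : (u, v) \in rcons hist e -> consec (val (upd w)) u v.
  by apply/allP => -[u v] /H.
move=> he'; have [_ _ h1 h2] := node_joined.
have ge' : graph (rcons hist e) u v by rewrite /graph he'.
have eS := edge_component e.1 ge'; rewrite !component_joined // in eS.
have qe' := allP tq _ he'; rewrite /= in qe'.
have t_mem x : x \in rearr (tgt w.2) = (x \in S) := mem_rearranged _ x.
case: (boolP (u \in S)) => e1S.
  have e2S : v \in S by rewrite -eS.
  have ct : consec (rearr (tgt w.2)) u v.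
    have cb : consec (rearr (tgt b)) u v.
      by rewrite eb; apply: consec_filterW; rewrite ?arrangement_uniq ?mem_arrangement.
    have [->//|nb] := eqVneq w.2 b.
    have -> : w.2 = ~~ b by case: w.2 b nb => -[].
    by rewrite rearranged_target consec_rev ?rearranged_uniq ?mem_rearranged.
  rewrite val_update /update_listing consec_catr ?mem_before ?e1S ?e2S //.
  by case: w.1; rewrite -?catA;
    [rewrite consec_catr ?mem_between ?e1S ?e2S //|]; rewrite consec_catl ?mem_rearranged.
have e2S : v \notin S by rewrite -eS.
have he : (u, v) \in hist.
  move: he'; rewrite mem_rcons inE => /orP[/eqP ee|//].
  by move: e1S; rewrite (_ : u = e.1) ?h1 // -ee.
have pe' : consec (val pi) u v := allP tpi _ he.
have [ul ur] := pos_outside e1S; have [vl vr] := pos_outside e2S.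
have H (P : pred V) : P u -> P v -> consec [seq x <- val pi | P x] u v.
  by move=> P1 P2; apply: consec_filterW; rewrite ?arrangement_uniq ?mem_arrangement.
have pe2 : (pos pi v == (pos pi u).+1) || (pos pi u == (pos pi v).+1) := pe'.
(* [u] and [v] are neighbours in [pi] and distinct from [l] and [r], so they lie on the same side of
   [l], and likewise of [r]. *)
have s1 : (pos pi u < pos pi l) = (pos pi v < pos pi l).
  by move: pe2 ul vl; clear; lia.
have s2 : (pos pi r < pos pi u) = (pos pi r < pos pi v).
  by move: pe2 ur vr; clear; lia.
have lr := left_lt_right.
rewrite val_update /update_listing.
case: (ltnP (pos pi u) (pos pi l)) => u1.
  rewrite consec_catl ?mem_before -?s1 ?e1S ?e2S ?u1 //.
  by apply: H; rewrite outsideE -?s1 ?e1S ?e2S u1.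
have v1 : pos pi l <= pos pi v by rewrite leqNgt -s1 -leqNgt.
rewrite consec_catr ?mem_before -?s1 ?e1S ?e2S -?leqNgt //=.
have b1 : (u \in between_blocks hist pi e) = ~~ (pos pi r < pos pi u).
  by rewrite mem_between e1S /=; move: u1 ul ur; clear; lia.
have b2 : (v \in between_blocks hist pi e) = ~~ (pos pi r < pos pi u).
  by rewrite mem_between e2S s2 /=; move: v1 vl vr; clear; lia.
case: (boolP (pos pi r < pos pi u)) => u2.
  rewrite consec_catr; first last.
  - by case: w.1; rewrite mem_cat b2 mem_rearranged u2 (negbTE e2S).
  - by case: w.1; rewrite mem_cat b1 mem_rearranged u2 (negbTE e1S).
  by apply: H; rewrite outsideE -?s2 ?e1S ?e2S u2.
have cb : consec (between_blocks hist pi e) u v.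
  by apply: H; move: b1 b2; rewrite !mem_filter !mem_arrangement !andbT u2.
rewrite consec_catl; last first.
- by case: w.1; rewrite mem_cat b2 u2 ?orbT.
- by case: w.1; rewrite mem_cat b1 u2 ?orbT.
case: w.1; first by rewrite consec_catl ?b1 ?b2.
by rewrite consec_catr ?mem_rearranged.
Qed.
End Target.

Lemma prec_left_outside u v : u \in L -> v \notin S ->
  prec (val pi) u v = (pos pi l < pos pi v).
Proof.
rewrite joinedE negb_or => uL /andP[vL _].
by rewrite (@prec_component _ hist pi l u l) ?mem_component_self.
Qed.

Lemma prec_right_outside u v : u \in R -> v \notin S ->
  prec (val pi) u v = (pos pi r < pos pi v).
Proof.
rewrite joinedE negb_or => uR /andP[_ vR].
by rewrite (@prec_component _ hist pi r u r) ?mem_component_self.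
Qed.

(** [pi] puts [v] after the left and before the right block, while [q] puts it on one side of both.
    So [v] disagrees for exactly one block. *)
Lemma inverted_between u v : u \in S -> v \in between_blocks hist pi e ->
  inverted pi q u v = ((u \in R) == prec (val q) l v).
Proof.
rewrite mem_between => uS /andP[vS /andP[lv vr]].
have nuv : u != v by apply: contraNneq vS => <-.
have [lS _ _ _] := node_joined.
rewrite /inverted nuv (prec_joined uS lS) //=.
move: uS; rewrite joinedE => /orP[] uX.
  rewrite prec_left_outside // lv (negbTE (left_right_disjoint uX)).
  by case: (prec _ _ _).
by rewrite prec_right_outside // uX ltnNge ltnW.
Qed.

Lemma inverted_update_between w u v : u \in S -> v \in between_blocks hist pi e ->
  inverted (upd w) q u v = (w.1 == prec (val q) l v).
Proof.
rewrite mem_between => uS /andP[vS /andP[lv vr]].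
have nuv : u != v by apply: contraNneq vS => <-.
have [lS _ _ _] := node_joined.
rewrite /inverted nuv (prec_joined uS lS) //= prec_update_mixed //.
by rewrite ltnNge ltnW //= ltnNge ltnW //=; case: w.1.
Qed.

Lemma inverted_update_not_between w u v : u \in S -> v \notin S ->
  v \notin between_blocks hist pi e -> inverted (upd w) q u v = inverted pi q u v.
Proof.
move=> uS vS; rewrite mem_between vS /= => nb.
rewrite /inverted prec_update_mixed //; congr (_ && (_ (+) _)).
have lr := left_lt_right; have [nl nr] := pos_outside vS.
move: uS; rewrite joinedE => /orP[] uX.
  by rewrite prec_left_outside //; move: nb nl nr lr; clear;
    case: (ltnP (pos pi v) (pos pi l)) => ?;
    last (case: (ltnP (pos pi r) (pos pi v)) => ?); lia.
by rewrite prec_right_outside //; move: nb nl nr lr; clear;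
    case: (ltnP (pos pi v) (pos pi l)) => ?;
    last (case: (ltnP (pos pi r) (pos pi v)) => ?); lia.
Qed.

Lemma inverted_update_outside w u v : u \notin S -> v \notin S ->
  inverted (upd w) q u v = inverted pi q u v.
Proof. by move=> uS vS; rewrite /inverted prec_update_outside. Qed.
End Step.

(** * Weights, potential and summation tools *)

(** The number of pairs flipped together with {u, v} when two components exchange places or one is
    reversed. *)
Definition weight (V : finType) (h : seq (V * V)) (u v : V) : nat :=
  if v \in component (graph h) u then 'C(#|component (graph h) u|, 2)
  else #|component (graph h) u| * #|component (graph h) v|.

(** Each disagreeing ordered pair holds the part of its budget ln n^2 not yet charged. On the
    diagonal the weight may be 0, but [inverted] is false there. *)
Definition potential (R : realType) (V : finType) (h : seq (V * V))
    (p q : arrangement V) : R :=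
  (\sum_u \sum_v (inverted p q u v)%:R *
     (ln ((#|V| ^ 2)%:R) - ln ((weight h u v)%:R)))%R.

Lemma weightC (V : finType) (h : seq (V * V)) (u v : V) :
  weight h u v = weight h v u.
Proof.
rewrite /weight (mem_componentC h v); case: ifP => [/component_eq-> //|_].
by rewrite mulnC.
Qed.

Section Sums.
Local Open Scope ring_scope.
Context {R : realType} {V : finType}.

(** This is ln z <= z - 1 at z = x / y. *)
Lemma one_sub_div_le_ln (x y : R) : 0 < x -> 0 < y ->
  1 - x / y <= ln y - ln x.
Proof.
move=> x0 y0; have h : -1 < x / y - 1 by have := divr_gt0 x0 y0; lra.
have := le_ln1Dx h; rewrite addrC subrK ln_div ?posrE //; lra.
Qed.

(** The case x = 0 occurs for a block with a single node, where binom(1, 2) = 0. *)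
Lemma mulr_one_sub_div_le (x y : R) : 0 <= x -> 0 < y ->
  x * (1 - x / y) <= x * (ln y - ln x).
Proof.
rewrite le_eqVlt => /orP[/eqP<-|x0] y0; first by rewrite !mul0r.
by rewrite ler_pM2l // one_sub_div_le_ln.
Qed.

Lemma bin2_natr (n : nat) : 2 * 'C(n, 2)%:R = n%:R * (n%:R - 1) :> R.
Proof.
elim: n => [|n IH]; first by rewrite bin0n mulr0 mul0r.
by rewrite binS bin1 natrD mulrDr IH -natr1; ring.
Qed.

Lemma sum_distinct_pairs (C : {set V}) (x : R) :
  \sum_(u in C) \sum_(v in C) (u != v)%:R * x = 2 * 'C(#|C|, 2)%:R * x.
Proof.
rewrite bin2_natr.
transitivity (\sum_(u in C) (#|C|%:R - 1) * x); last first.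
  by rewrite sumr_const -[LHS]mulr_natl mulrA.
apply: eq_bigr => u uC; rewrite -big_distrl /=; congr (_ * _).
rewrite (bigD1 u) //= eqxx add0r.
rewrite (eq_bigr (fun=> 1)) => [|v /andP[_ vu]]; last by rewrite eq_sym vu.
rewrite sumr_const (cardsD1 u) uC natrD addrC addKr; congr (_%:R).
by apply: eq_card => v; rewrite !inE andbC.
Qed.

Lemma sum_const_mem (C : {set V}) (x : R) : \sum_(u in C) x = #|C|%:R * x.
Proof. by rewrite sumr_const mulr_natl. Qed.

(** With [C] the joined component: outer pairs are unaffected, mixed pairs (counted in both orders)
    pay for moving, and inner pairs pay for rearranging. *)
Lemma sum_symmetric_split (C : {set V}) (F : V -> V -> R) :
  (forall u v, F u v = F v u) ->
  \sum_u \sum_v F u v =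
    \sum_(u | u \notin C) \sum_(v | v \notin C) F u v
    + 2 * (\sum_(v | v \notin C) \sum_(u in C) F u v)
    + \sum_(u in C) \sum_(v in C) F u v.
Proof.
move=> Fsym; rewrite (bigID (mem C)) /=.
rewrite (eq_bigr (fun u => \sum_(v in C) F u v + \sum_(v | v \notin C) F u v));
  last by move=> u _; rewrite (bigID (mem C)).
rewrite [X in _ + X](eq_bigr (fun u => \sum_(v in C) F u v + \sum_(v | v \notin C) F u v));
  last by move=> u _; rewrite (bigID (mem C)).
rewrite !big_split /= [X in _ + X + _]exchange_big /=.
have -> : \sum_(u | u \notin C) \sum_(v in C) F u v =
    \sum_(v | v \notin C) \sum_(u in C) F u v.
  by apply: eq_bigr => v _; apply: eq_bigr => u _; apply: Fsym.
ring.
Qed.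
End Sums.

(** * Expected change of the potential in one update *)

Section Step.
Local Open Scope ring_scope.
Context {R : realType} {V : finType} (hist : seq (V * V)) (e : V * V).
Context (pi q : arrangement V).
Context (nXZ : component (graph hist) e.1 != component (graph hist) e.2).
Context (tpi : tight hist pi) (tq : tight (rcons hist e) q).

Local Notation l := (left_node pi e).
Local Notation r := (right_node pi e).
Local Notation L := (component (graph hist) l).
Local Notation Rt := (component (graph hist) r).
Local Notation S := (joined hist e).
Local Notation upd := (update hist pi e).
Local Notation rearr := (rearranged hist pi e).
Local Notation tgt := (target hist pi e).
Local Notation mp := (move_prob hist pi e R).
Local Notation tp := (target_prob hist pi e R).
Local Notation gain h u v := (ln ((#|V| ^ 2)%:R) - ln ((weight h u v)%:R) : R).
Local Notation h' := (rcons hist e).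

Lemma sum_joined (F : V -> R) :
  \sum_(u in S) F u = \sum_(u in L) F u + \sum_(u in Rt) F u.
Proof.
rewrite (bigID (mem L)) /=; congr (_ + _); apply: eq_bigl => u.
  by rewrite (joinedE hist e pi) andbC; case: (u \in L).
rewrite (joinedE hist e pi); case: (boolP (u \in L)) => uL /=.
  by rewrite (negbTE (left_right_disjoint nXZ uL)).
by rewrite andbT.
Qed.

Lemma card_joined : #|S| = (#|L| + #|Rt|)%N.
Proof.
rewrite -cardsUI (_ : L :&: Rt = set0) ?cards0 ?addn0.
  by apply: eq_card => u; rewrite in_setU (joinedE hist e pi).
apply/setP=> u; rewrite in_setI in_set0; apply/negbTE/negP => /andP[uL].
by rewrite (negbTE (left_right_disjoint nXZ uL)).
Qed.

Lemma card_component_gt0 h (u : V) : (0 < #|component (graph h) u|)%N.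
Proof. by apply/card_gt0P; exists u; apply: mem_component_self. Qed.

Lemma sum_move_prob : mp true + mp false = 1.
Proof.
rewrite /move_prob !size_block -mulrDl -natrD addnC divff // pnatr_eq0.
by have := card_component_gt0 hist l; lia.
Qed.

Lemma bin2D a b : 'C(a + b, 2) = ('C(a, 2) + a * b + 'C(b, 2))%N.
Proof.
elim: a => [|a IH]; first by rewrite bin0n.
by rewrite addSn !binS !bin1 IH; lia.
Qed.

Lemma rearranged_costE c : rearranged_cost hist pi e c =
  (c.1.1 * 'C(#|L|, 2) + c.1.2 * (#|L| * #|Rt|) + c.2 * 'C(#|Rt|, 2))%N.
Proof. by rewrite /rearranged_cost !size_block. Qed.

Lemma rearranged_cost_target b :
  (rearranged_cost hist pi e (tgt b) + rearranged_cost hist pi e (tgt (~~ b)))%N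
  = 'C(#|S|, 2).
Proof.
rewrite card_joined bin2D !rearranged_costE /target.
by case: b; case: base_combination => [[[] []] []] /=; lia.
Qed.

Lemma bin_joined_gt0 : (0 < 'C(#|S|, 2))%N.
Proof.
rewrite bin_gt0 card_joined.
by have := card_component_gt0 hist l; have := card_component_gt0 hist r; lia.
Qed.

Lemma target_probE b : tp b = (rearranged_cost hist pi e (tgt (~~ b)))%:R / 'C(#|S|, 2)%:R.
Proof. by rewrite /target_prob !size_block -card_joined. Qed.

Lemma sum_target_prob b : tp b + tp (~~ b) = 1.
Proof.
rewrite !target_probE -mulrDl -natrD addnC negbK.
rewrite rearranged_cost_target divff // pnatr_eq0.
by have := bin_joined_gt0; lia.
Qed.

(** The two coins are independent and each has total probability 1, so a separable cost splits into
    two expectations. *)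
Lemma sum_update_prob (f g : bool -> R) :
  \sum_(w : bool * bool) update_prob hist pi e R w * (f w.1 + g w.2)
  = \sum_a mp a * f a + \sum_b tp b * g b.
Proof.
rewrite -(pair_bigA _ (fun a b => update_prob hist pi e R (a, b) * (f a + g b))) /=.
rewrite !big_bool /= /update_prob /=.
have em : mp true = 1 - mp false by rewrite -sum_move_prob addrK.
have et : tp true = 1 - tp false by rewrite -(sum_target_prob true) addrK.
rewrite em et; ring.
Qed.

Lemma weight_outside u v : u \notin S -> v \notin S ->
  weight h' u v = weight hist u v.
Proof. by move=> uS vS; rewrite /weight !component_rcons (negbTE uS) (negbTE vS). Qed.

Lemma weight_joined_mixed u v : u \in S -> v \notin S ->
  weight h' u v = (#|S| * #|component (graph hist) v|)%N.
Proof. by move=> uS vS; rewrite /weight !component_rcons uS (negbTE vS). Qed.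

Lemma weight_joined u v : u \in S -> v \in S -> weight h' u v = 'C(#|S|, 2).
Proof. by move=> uS vS; rewrite /weight !component_rcons uS vS. Qed.

Lemma weight_same a u v : u \in component (graph hist) a ->
  v \in component (graph hist) a ->
  weight hist u v = 'C(#|component (graph hist) a|, 2).
Proof. by move=> ua va; rewrite /weight (component_eq ua) va. Qed.

Lemma weight_other a u v : u \in component (graph hist) a ->
  v \notin component (graph hist) a ->
  weight hist u v = (#|component (graph hist) a| * #|component (graph hist) v|)%N.
Proof. by move=> ua va; rewrite /weight (component_eq ua) (negbTE va). Qed.

(** The rearranging coin is fixed to [true]: by [inverted_update_mixed] it does not affect pairs
    with one node outside the joined component. *)
Definition moved_gain (v : V) (a : bool) : R :=
  \sum_(u in S) (inverted (upd (a, true)) q u v)%:R * gain h' u v.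

Lemma inverted_update_mixed w u v : u \in S -> v \notin S ->
  inverted (upd w) q u v = inverted (upd (w.1, true)) q u v.
Proof.
move=> uS vS; case: (boolP (v \in between_blocks hist pi e)) => vb.
  by rewrite !(inverted_update_between nXZ tpi tq).
by rewrite !inverted_update_not_between.
Qed.

(* The moving cost of passing v is charged half to the pairs (u, v) and half to the
   pairs (v, u), hence the division by 2. *)
Lemma expected_moved_gain v : v \notin S ->
  \sum_a mp a * ((v \in between_blocks hist pi e)%:R * ((if a then #|L| else #|Rt|)%:R / 2)
     + moved_gain v a)
  <= \sum_(u in S) (inverted pi q u v)%:R * gain hist u v.
Proof.
move=> vS; have := vS; rewrite (joinedE hist e pi) negb_or => /andP[vL vR].
have a0 := card_component_gt0 hist l; have b0 := card_component_gt0 hist r.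
have y0 := card_component_gt0 hist v.
set a := #|L| in a0 *; set b := #|Rt| in b0 *; set y := #|_| in y0.
have es : #|S|%:R = a%:R + b%:R :> R by rewrite card_joined natrD.
have [a0' b0' y0'] : [/\ 0 < a%:R :> R, 0 < b%:R :> R & 0 < y%:R :> R].
  by rewrite !ltr0n.
have s0 : 0 < a%:R + b%:R :> R by apply: addr_gt0.
have gS u : u \in S -> gain h' u v = ln ((#|V| ^ 2)%:R) - ln ((a%:R + b%:R) * y%:R).
  by move=> uS; rewrite weight_joined_mixed // natrM es.
have gL u : u \in L -> gain hist u v = ln ((#|V| ^ 2)%:R) - ln (a%:R * y%:R).
  by move=> uL; rewrite (weight_other uL) // natrM.
have gR u : u \in Rt -> gain hist u v = ln ((#|V| ^ 2)%:R) - ln (b%:R * y%:R).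
  by move=> uR; rewrite (weight_other uR) // natrM.
have empt : mp true = b%:R / (a%:R + b%:R) by rewrite /move_prob !size_block natrD.
have empf : mp false = a%:R / (a%:R + b%:R) by rewrite /move_prob !size_block natrD.
set K := ln _ in gS gL gR.
(* Joining raises the weight from w = a y to w' = (a + b) y, and 1 - w / w' = b / (a + b). *)
have dL : b%:R / (a%:R + b%:R) <= (K - ln (a%:R * y%:R)) - (K - ln ((a%:R + b%:R) * y%:R)).
  have := @one_sub_div_le_ln R (a%:R * y%:R) ((a%:R + b%:R) * y%:R).
  rewrite !mulr_gt0 // -mulf_div divff ?gt_eqF // mulr1 => /(_ isT isT).
  have -> : 1 - a%:R / (a%:R + b%:R) = b%:R / (a%:R + b%:R) :> R by field; lra.
  lra.
have dR : a%:R / (a%:R + b%:R) <= (K - ln (b%:R * y%:R)) - (K - ln ((a%:R + b%:R) * y%:R)).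
  have := @one_sub_div_le_ln R (b%:R * y%:R) ((a%:R + b%:R) * y%:R).
  rewrite !mulr_gt0 // -mulf_div divff ?gt_eqF // mulr1 => /(_ isT isT).
  have -> : 1 - b%:R / (a%:R + b%:R) = a%:R / (a%:R + b%:R) :> R by field; lra.
  lra.
case: (boolP (v \in between_blocks hist pi e)) => vb.
  have mE c : moved_gain v c =
      (a%:R + b%:R) * ((c == prec (val q) l v)%:R * (K - ln ((a%:R + b%:R) * y%:R))).
    rewrite /moved_gain -[X in _ = X * _]es -sum_const_mem; apply: eq_bigr => u uS.
    by rewrite gS // (inverted_update_between nXZ tpi tq).
  rewrite sum_joined.
  have -> : \sum_(u in L) (inverted pi q u v)%:R * gain hist u v =
      a%:R * ((~~ prec (val q) l v)%:R * (K - ln (a%:R * y%:R))).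
    rewrite -sum_const_mem; apply: eq_bigr => u uL.
    rewrite gL // (inverted_between nXZ tpi tq) ?(joinedE hist e pi) ?uL //.
    by rewrite (negbTE (left_right_disjoint nXZ uL)).
  have -> : \sum_(u in Rt) (inverted pi q u v)%:R * gain hist u v =
      b%:R * ((prec (val q) l v)%:R * (K - ln (b%:R * y%:R))).
    rewrite -sum_const_mem; apply: eq_bigr => u uR.
    by rewrite gR // (inverted_between nXZ tpi tq) ?(joinedE hist e pi) ?uR ?orbT.
  rewrite big_bool /= !mE empt empf -/a -/b !mul1r.
  (* If [q] puts [v] right of the joined block, the b nodes of the right block disagree with it.
     Half the expected moving cost is a b / (a + b), that is a / (a + b) per disagreeing pair, which
     [dR] supplies. The other case is symmetric, with [dL]. *)
  case: (prec (val q) l v) => /=; rewrite !mul0r !mulr0 !mul1r.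
    have -> : forall x : R, b%:R / (a%:R + b%:R) * (a%:R / 2 + (a%:R + b%:R) * x) +
       a%:R / (a%:R + b%:R) * (b%:R / 2 + 0) = b%:R * (a%:R / (a%:R + b%:R) + x).
      by move=> x; field; lra.
    rewrite add0r ler_pM2l //; move: dR; lra.
  have -> : forall x : R, b%:R / (a%:R + b%:R) * (a%:R / 2 + 0) +
     a%:R / (a%:R + b%:R) * (b%:R / 2 + (a%:R + b%:R) * x) = a%:R * (b%:R / (a%:R + b%:R) + x).
    by move=> x; field; lra.
  rewrite addr0 ler_pM2l //; move: dL; lra.
rewrite big_bool /= !mul0r !add0r.
(* Nothing moves past [v]: the disagreements stay, and growing weights only lower the remaining
   budgets. *)
have mE c : moved_gain v c <= \sum_(u in S) (inverted pi q u v)%:R * gain hist u v.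
  apply: ler_sum => u uS; rewrite inverted_update_not_between //.
  apply: ler_wpM2l => //; rewrite gS //.
  have [d1 d2] : 0 <= b%:R / (a%:R + b%:R) :> R /\ 0 <= a%:R / (a%:R + b%:R) :> R.
    by split; rewrite divr_ge0 // ltW.
  move: uS; rewrite (joinedE hist e pi) => /orP[uL|uR].
    by rewrite gL //; move: dL d1; lra.
  by rewrite gR //; move: dR d2; lra.
set G := \sum_(u in S) _ in mE *.
have [p1 p2] : 0 <= mp true /\ 0 <= mp false.
  by rewrite empt empf; split; rewrite divr_ge0 // ltW.
rewrite -[leRHS]mul1r -sum_move_prob mulrDl lerD // ler_wpM2l //.
Qed.

(** Let c0 and c1 be the costs of target [b] and of its reverse, and B = c0 + c1. The expected cost
    is 2 c0 c1 / B, while the expected number of disagreeing ordered pairs stays 2 c0. So raising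
    the weights has to release 2 c0 (1 - c0 / B). *)
Lemma expected_rearranged_gain b :
  rearr (tgt b) = [seq v <- val q | v \in S] ->
  \sum_c tp c * ((rearranged_cost hist pi e (tgt c))%:R +
     \sum_(u in S) \sum_(v in S) (inverted (upd (true, c)) q u v)%:R * gain h' u v)
  <= \sum_(u in S) \sum_(v in S) (inverted pi q u v)%:R * gain hist u v.
Proof.
move=> eb; set K := ln ((#|V| ^ 2)%:R).
have nE (p : arrangement V) u v : inverted p q u v = (u != v) && inverted p q u v.
  by rewrite /inverted; case: (u != v).
have T c : \sum_(u in S) \sum_(v in S) (inverted (upd (true, c)) q u v)%:R * gain h' u v
    = (c != b)%:R * (2 * 'C(#|S|, 2)%:R * (K - ln ('C(#|S|, 2)%:R))).
  rewrite -sum_distinct_pairs mulr_sumr; apply: eq_bigr => u uS.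
  rewrite mulr_sumr; apply: eq_bigr => v vS; rewrite weight_joined //.
  case: (eqVneq u v) => [->|nuv]; first by rewrite nE eqxx !mul0r mulr0.
  by rewrite (inverted_update_joined nXZ eb) // mul1r.
have -> : \sum_(u in S) \sum_(v in S) (inverted pi q u v)%:R * gain hist u v =
    2 * ((tgt b).1.1%:R * 'C(#|L|, 2)%:R * (K - ln ('C(#|L|, 2)%:R))
       + (tgt b).1.2%:R * (#|L| * #|Rt|)%:R * (K - ln ((#|L| * #|Rt|)%:R))
       + (tgt b).2%:R * 'C(#|Rt|, 2)%:R * (K - ln ('C(#|Rt|, 2)%:R))).
  rewrite sum_joined.
  under eq_bigr do rewrite sum_joined.
  under [X in _ + X]eq_bigr do rewrite sum_joined.
  rewrite !big_split /= [X in _ + (X + _)]exchange_big /=.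
  have -> : \sum_(u in L) \sum_(v in L) (inverted pi q u v)%:R * gain hist u v =
      (tgt b).1.1%:R * (2 * 'C(#|L|, 2)%:R * (K - ln ('C(#|L|, 2)%:R))).
    rewrite -sum_distinct_pairs mulr_sumr; apply: eq_bigr => u uL.
    rewrite mulr_sumr; apply: eq_bigr => v vL; rewrite (weight_same uL vL).
    case: (eqVneq u v) => [->|nuv]; first by rewrite nE eqxx !mul0r mulr0.
    by rewrite (inverted_left nXZ eb) // mul1r.
  have -> : \sum_(u in Rt) \sum_(v in Rt) (inverted pi q u v)%:R * gain hist u v =
      (tgt b).2%:R * (2 * 'C(#|Rt|, 2)%:R * (K - ln ('C(#|Rt|, 2)%:R))).
    rewrite -sum_distinct_pairs mulr_sumr; apply: eq_bigr => u uL.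
    rewrite mulr_sumr; apply: eq_bigr => v vL; rewrite (weight_same uL vL).
    case: (eqVneq u v) => [->|nuv]; first by rewrite nE eqxx !mul0r mulr0.
    by rewrite (inverted_right nXZ eb) // mul1r.
  have -> : \sum_(u in L) \sum_(v in Rt) (inverted pi q u v)%:R * gain hist u v =
      (tgt b).1.2%:R * ((#|L| * #|Rt|)%:R * (K - ln ((#|L| * #|Rt|)%:R))).
    set k := K - _; rewrite natrM -[X in _ * X]mulrA -!sum_const_mem mulr_sumr.
    apply: eq_bigr => u uL; rewrite mulr_sumr; apply: eq_bigr => v vR; rewrite /k.
    have vL : v \notin L by apply/negP => /(left_right_disjoint nXZ); rewrite vR.
    by rewrite (weight_other uL vL) (component_eq vR) (inverted_left_right nXZ tpi tq eb).
  have -> : \sum_(j in L) \sum_(i in Rt) (inverted pi q i j)%:R * gain hist i j =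
      (tgt b).1.2%:R * ((#|L| * #|Rt|)%:R * (K - ln ((#|L| * #|Rt|)%:R))).
    set k := K - _; rewrite natrM -[X in _ * X]mulrA -!sum_const_mem mulr_sumr.
    apply: eq_bigr => u uL; rewrite mulr_sumr; apply: eq_bigr => v vR; rewrite /k.
    have vL : v \notin L by apply/negP => /(left_right_disjoint nXZ); rewrite vR.
    by rewrite weightC (weight_other uL vL) (component_eq vR) invertedC
      (inverted_left_right nXZ tpi tq eb).
  ring.
have -> (F : bool -> R) : \sum_c F c = F b + F (~~ b).
  by rewrite big_bool; case: (b) => //=; rewrite addrC.
rewrite !T eqxx (_ : ~~ b != b); last by case: (b).
rewrite !target_probE negbK mul0r !addr0 mul1r.
have ec := rearranged_cost_target b.
set c0 := rearranged_cost _ _ _ (tgt b) in ec *.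
set c1 := rearranged_cost _ _ _ (tgt (~~ b)) in ec *.
set B := 'C(#|S|, 2) in ec *.
have B0 : 0 < B%:R :> R by rewrite ltr0n bin_joined_gt0.
have ec1 : c1%:R = B%:R - c0%:R :> R by rewrite -ec natrD addrC addKr.
(* Target [b] has probability c1 / B and leaves no disagreement; its reverse has probability c0 / B
   and leaves all 2 B ordered pairs in disagreement. *)
have -> : c1%:R / B%:R * c0%:R + c0%:R / B%:R * (c1%:R + 2 * B%:R * (K - ln B%:R))
    = 2 * (c0%:R * (1 - c0%:R / B%:R) + c0%:R * (K - ln B%:R)) :> R.
  by rewrite ec1; field; rewrite gt_eqF.
rewrite ler_pM2l ?ltr0n //.
have c0E : c0 = _ := rearranged_costE (tgt b).
(* Only the operations with d = true contribute to c0, and each of them satisfies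
   x * (1 - c0 / B) <= x * (1 - x / B) <= x * (ln B - ln x). *)
have key (d : bool) (x : nat) : (d * x <= c0)%N ->
    d%:R * x%:R * (1 - c0%:R / B%:R) + d%:R * x%:R * (K - ln B%:R)
    <= d%:R * x%:R * (K - ln x%:R) :> R.
  case: d => /= xc; last by rewrite !mul0r addr0.
  rewrite !mul1r -mulrDr.
  have h1 : x%:R * (1 - c0%:R / B%:R) <= x%:R * (1 - x%:R / B%:R) :> R.
    apply: ler_wpM2l => //; rewrite lerD2l lerN2 ler_pM2r ?invr_gt0 // ler_nat.
    by move: xc; rewrite mul1n.
  have h2 := @mulr_one_sub_div_le R x%:R B%:R (ler0n _ _) B0.
  move: h1 h2; clear; lra.
have k1 : ((tgt b).1.1 * 'C(#|L|, 2) <= c0)%N by rewrite c0E; lia.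
have k2 : ((tgt b).1.2 * (#|L| * #|Rt|) <= c0)%N by rewrite c0E; lia.
have k3 : ((tgt b).2 * 'C(#|Rt|, 2) <= c0)%N by rewrite c0E; lia.
have {k1} := key _ _ k1; have {k2} := key _ _ k2; have {k3} := key _ _ k3.
have -> : c0%:R = (tgt b).1.1%:R * 'C(#|L|, 2)%:R + (tgt b).1.2%:R * (#|L| * #|Rt|)%:R
   + (tgt b).2%:R * 'C(#|Rt|, 2)%:R :> R by rewrite c0E !natrD !natrM.
set x1 := _ * 'C(#|L|, 2)%:R; set x2 := _ * (#|L| * #|Rt|)%:R; set x3 := _ * 'C(#|Rt|, 2)%:R.
clear; move: (_ / _) (ln _) (ln _) (ln _) (ln _) => *; lra.
Qed.

(** The potential pays for the update in expectation: cost plus new potential is a constant plus one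
    function of each coin, and each function is bounded separately. *)
Lemma potential_step :
  \sum_w update_prob hist pi e R w *
    ((update_cost hist pi e w)%:R + potential R h' (upd w) q)
  <= potential R hist pi q.
Proof.
have [b eb] := target_filter_joined nXZ tpi tq.
have sym h p u v : (inverted p q u v)%:R * gain h u v = (inverted p q v u)%:R * gain h v u.
  by rewrite invertedC weightC.
rewrite [leRHS](sum_symmetric_split S); last exact: sym.
set A := \sum_(u | u \notin S) \sum_(v | v \notin S) _.
pose f a := (move_cost hist pi e a)%:R + 2 * (\sum_(v | v \notin S) moved_gain v a) : R.
pose g c := (rearranged_cost hist pi e (tgt c))%:R +
     \sum_(u in S) \sum_(v in S) (inverted (upd (true, c)) q u v)%:R * gain h' u v.
have E w : (update_cost hist pi e w)%:R + potential R h' (upd w) q = f w.1 + (A + g w.2).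
  rewrite /potential (sum_symmetric_split S) //.
  have -> : \sum_(u | u \notin S) \sum_(v | v \notin S) (inverted (upd w) q u v)%:R * gain h' u v = A.
    apply: eq_bigr => u uS; apply: eq_bigr => v vS.
    by rewrite inverted_update_outside // weight_outside.
  have -> : \sum_(v | v \notin S) \sum_(u in S) (inverted (upd w) q u v)%:R * gain h' u v =
     \sum_(v | v \notin S) moved_gain v w.1.
    apply: eq_bigr => v vS; apply: eq_bigr => u uS.
    by rewrite inverted_update_mixed.
  have -> : \sum_(u in S) \sum_(v in S) (inverted (upd w) q u v)%:R * gain h' u v =
     \sum_(u in S) \sum_(v in S) (inverted (upd (true, w.2)) q u v)%:R * gain h' u v.
    apply: eq_bigr => u uS; apply: eq_bigr => v vS.
    case: (eqVneq u v) => [->|nuv]; first by rewrite /inverted eqxx.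
    by rewrite !(inverted_update_joined nXZ eb).
  rewrite /f /g /update_cost natrD; ring.
rewrite (eq_bigr (fun w => update_prob hist pi e R w * (f w.1 + (A + g w.2))));
  last by move=> w _; rewrite E.
rewrite (sum_update_prob f (fun c => A + g c)).
have -> : \sum_c tp c * (A + g c) = A + \sum_c tp c * g c.
  rewrite !big_bool /= -[in RHS](mulr1 A) -(sum_target_prob true) /=; ring.
rewrite addrCA -addrA lerD2l lerD //; last exact: expected_rearranged_gain eb.
(* The moving cost is distributed over the nodes that are passed, to be compared with the mixed
   pairs of each node. *)
have -> : \sum_a mp a * f a = 2 * \sum_(v | v \notin S) \sum_a mp a *
   ((v \in between_blocks hist pi e)%:R * ((if a then #|L| else #|Rt|)%:R / 2)
     + moved_gain v a).
  rewrite exchange_big /= mulr_sumr; apply: eq_bigr => a _.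
  rewrite -mulr_sumr mulrCA; congr (_ * _); rewrite big_split /= mulrDr; congr (_ + _).
  rewrite -mulr_suml.
  have -> : \sum_(v | v \notin S) (v \in between_blocks hist pi e)%:R =
      (size (between_blocks hist pi e))%:R :> R.
    rewrite -natr_sum; congr (_%:R).
    have ub : uniq (between_blocks hist pi e) by rewrite filter_uniq ?arrangement_uniq.
    rewrite -(card_uniqP ub) -sum1_card big_mkcond [RHS]big_mkcond.
    apply: eq_bigr => v _; rewrite mem_between.
    by case: (v \in S) => //=; case: ifP.
  rewrite /move_cost !size_block natrM.
  by case: a => /=; field.
rewrite ler_pM2l ?ltr0n //; apply: ler_sum => v vS; exact: expected_moved_gain.
Qed.
End Step.

(** * Disagreeing pairs as a lower bound for the cost of a solution *)

Definition inversions (V : finType) (p q : arrangement V) : nat :=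
  #|[set uv : V * V | inverted p q uv.1 uv.2]|.

Section Inversions.
Context {V : finType}.
Implicit Types (p q r : arrangement V) (s : seq (arrangement V)).

Lemma inversions_refl p : inversions p p = 0.
Proof.
apply/eqP; rewrite cards_eq0; apply/eqP/setP => uv; rewrite !inE /inverted.
by rewrite addbb andbF.
Qed.

Lemma inversions_trans p q r : inversions p q <= inversions p r + inversions r q.
Proof.
apply: leq_trans (leq_card_setU _ _); apply/subset_leq_card/subsetP => uv.
rewrite !inE => h; have := inverted_trans p q r uv.1 uv.2; rewrite h.
by case: (inverted p r _ _); case: (inverted r q _ _).
Qed.

(** No position lies strictly between those of the exchanged nodes, so only their own pair changes
    order; it is counted in both orders. *)
Lemma adj_swap_inversions p r : adj_swap p r -> inversions p r <= 2.
Proof.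
case/existsP=> x /existsP[y /andP[/eqP exy /eqP er]].
have posr u : pos r u = pos p (tperm x y u).
  rewrite /pos er -{1}(tpermK x y u) index_map //; exact: perm_inj.
suff sub : [set uv : V * V | inverted p r uv.1 uv.2] \subset [set (x, y); (y, x)].
  apply: leq_trans (subset_leq_card sub) _.
  by rewrite cards2; case: (_ != _).
apply/subsetP => -[u v]; rewrite !inE /inverted /= => /andP[nuv].
rewrite /prec -!/(pos _ _) !posr => inv_uv.
have inj a b : (pos p a == pos p b) = (a == b) by apply/inj_eq/pos_inj.
have xE w : (w == x) = (pos p w == pos p x) by rewrite inj.
have yE w : (w == y) = (pos p w == (pos p x).+1) by rewrite -exy inj.
rewrite !xpair_eqE; move: inv_uv; apply: contraLR.
move: nuv; rewrite -inj !xE !yE.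
case: (tpermP x y u) => [->|->|/eqP+ /eqP+]; rewrite ?xE ?yE;
  case: (tpermP x y v) => [->|->|/eqP+ /eqP+]; rewrite ?xE ?yE ?exy; clear; lia.
Qed.

Lemma path_inversions p s : path (@adj_swap V) p s ->
  inversions p (last p s) <= 2 * size s.
Proof.
elim: s p => [|r s IH] p /=; first by rewrite inversions_refl.
case/andP=> /adj_swap_inversions h /IH hs.
by apply: leq_trans (inversions_trans p _ r) _; rewrite mulnS leq_add.
Qed.

Lemma kendall_tau_inversions p q : inversions p q <= 2 * kendall_tau p q.
Proof.
rewrite /kendall_tau; case: ex_minnP => m /existsP[s /andP[ps /eqP<-]] _.
by rewrite -[X in 2 * X](size_tuple s); apply: path_inversions.
Qed.

Lemma solution_inversions p s : inversions p (last p s) <= 2 * solution_cost p s.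
Proof.
(* The default of [nth] in [solution_cost] is the initial permutation, which changes in the
   induction; it is replaced by an arbitrary [d]. *)
suff H d : inversions p (last p s) <=
    2 * \sum_(i < size s) kendall_tau (nth d (p :: s) i) (nth d (p :: s) i.+1).
  exact: H.
elim: s p => [|r s IH] p /=; first by rewrite inversions_refl.
rewrite big_ord_recl mulnDr; apply: leq_trans (inversions_trans p _ r) _.
by rewrite leq_add ?kendall_tau_inversions.
Qed.
End Inversions.

(** * MinLAs of disjoint unions of paths *)

Section Minla.
Context {V : finType}.
Implicit Types (es : seq (V * V)) (p : arrangement V).

Lemma uniq_flatten_map (I : eqType) (g : I -> seq V) (s : seq I) :
  uniq s -> (forall i, uniq (g i)) ->
  (forall i j u, i \in s -> j \in s -> u \in g i -> u \in g j -> i = j) ->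
  uniq (flatten [seq g i | i <- s]).
Proof.
elim: s => //= i s IH /andP[nis us] ug h; rewrite cat_uniq ug IH //=; last first.
  by move=> a b u ai bi; apply: h; rewrite inE ?ai ?bi orbT.
rewrite andbT; apply/hasPn => u /flattenP[t /mapP[j js ->] uj].
apply/negP => ui; case/negP: nis; rewrite (h i j u) ?mem_head //.
by rewrite inE js orbT.
Qed.

(** Concatenate path listings of the components, one for each root; an edge stays inside one of
    these listings. *)
Lemma tight_ex es : disjoint_paths (graph es) -> exists p : arrangement V, tight es p.
Proof.
move=> dp; pose g x := xchoose (dp x).
have gP x : path_order (graph es) (component (graph es) x) (g x) := xchooseP (dp x).
have gU x : uniq (g x) by have [] := path_orderP (gP x).
have gM x : g x =i component (graph es) x by have [] := path_orderP (gP x).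
have sG := graph_connect_sym es.
pose roots_es := enum (roots (graph es)).
pose s := flatten [seq g x | x <- roots_es].
have rootP x u : x \in roots_es -> u \in g x -> x = fingraph.root (graph es) u.
  rewrite mem_enum gM !inE => /eqP rx xu.
  by rewrite -{1}rx; apply/eqP; rewrite (root_connect sG).
have us : uniq s.
  apply: uniq_flatten_map => [||x y u xr yr ux uy]; rewrite ?enum_uniq //.
  by rewrite (rootP x u) // (rootP y u).
have memg u : u \in g (fingraph.root (graph es) u).
  by rewrite gM inE sG connect_root.
have rmem u : fingraph.root (graph es) u \in roots_es by rewrite mem_enum; apply: roots_root.
have sM u : u \in s.
  by apply/flattenP; exists (g (fingraph.root (graph es) u)); rewrite ?map_f.
have ps : s \in permutations (enum V).
  rewrite mem_permutations; apply: uniq_perm => // [|u]; first exact: enum_uniq.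
  by rewrite mem_enum sM.
exists (SeqSub ps).
suff H (u v : V) : (u, v) \in es -> consec s u v by apply/allP => -[u v] /H.
move=> uv; have guv : graph es u v by rewrite /graph uv.
have vg : v \in g (fingraph.root (graph es) u).
  by have := memg u; rewrite !gM (edge_component _ guv).
have cg : consec (g (fingraph.root (graph es) u)) u v.
  have [_ _ <-] := path_orderP (gP (fingraph.root (graph es) u)); rewrite -?gM //.
have [s1 [s2 er]] : exists s1 s2, roots_es = s1 ++ fingraph.root (graph es) u :: s2.
  by case/splitPr: (rmem u) => s1 s2; exists s1, s2.
have es_cat : s = flatten [seq g x | x <- s1] ++
    (g (fingraph.root (graph es) u) ++ flatten [seq g x | x <- s2]).
  by rewrite /s er map_cat flatten_cat.
rewrite es_cat; rewrite es_cat in us.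
have nin w : w \in g (fingraph.root (graph es) u) ->
    w \notin flatten [seq g x | x <- s1].
  move=> wg; move: us; rewrite cat_uniq => /and3P[_ /hasPn/(_ w) h _].
  by apply: h; rewrite mem_cat wg.
by rewrite consec_catr ?nin // consec_catl.
Qed.

Lemma edge_neq es u v : disjoint_paths (graph es) -> graph es u v -> u != v.
Proof.
move=> dp guv; have [s ps] := dp u; have [_ _ h] := path_orderP ps.
apply: contraTneq guv => <-; rewrite h ?mem_component_self // /consec orbb.
by rewrite -[X in X == _]addn0 -addn1 eqn_add2l.
Qed.

(** Summing over both orientations of each edge gives the symmetric distance as a sum of two
    truncated differences, one of which is 0. *)
Lemma double_arrangement_cost es p : 2 * arrangement_cost (graph es) p =
  \sum_(uv | graph es uv.1 uv.2)
    ((pos p uv.2 - pos p uv.1) + (pos p uv.1 - pos p uv.2)).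
Proof.
have E : arrangement_cost (graph es) p =
    \sum_(uv | graph es uv.1 uv.2) (pos p uv.2 - pos p uv.1).
  rewrite /arrangement_cost -(pair_big_dep predT (graph es)
    (fun u v => pos p v - pos p u)) /=.
  apply: eq_bigr => u _; rewrite big_mkcondr; apply: eq_bigr => v _.
  by case: ltnP => // h; apply/esym/eqP; rewrite subn_eq0.
rewrite big_split /= mulSn mul1n {1}E; congr (_ + _).
rewrite E (reindex_inj (h := fun uv : V * V => (uv.2, uv.1))) /=; last first.
  by move=> [a b] [c d] [-> ->].
by apply: eq_bigl => uv; rewrite graph_sym.
Qed.

(** A tight permutation gives every edge length 1, and no edge can be shorter. A minimizer therefore
    has no edge longer than 1. *)
Lemma minla_tight es p : disjoint_paths (graph es) -> minla (graph es) p ->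
  tight es p.
Proof.
move=> dp /forallP mp; have [t tt] := tight_ex dp.
have := mp t; rewrite -(@leq_pmul2l 2) // !double_arrangement_cost.
have dist1 uv : graph es uv.1 uv.2 ->
    (pos t uv.2 - pos t uv.1) + (pos t uv.1 - pos t uv.2) = 1.
  by move=> /(tight_graph tt); rewrite /consec -!/(pos t _); clear; lia.
rewrite [leqRHS](eq_bigr (fun=> 1)) // => le.
suff H (u v : V) : (u, v) \in es -> consec (val p) u v.
  by apply/allP => -[u v] /H.
move=> uv_es; have guv : graph es u v by rewrite /graph uv_es.
have ge1 uv : graph es uv.1 uv.2 ->
    1 <= (pos p uv.2 - pos p uv.1) + (pos p uv.1 - pos p uv.2).
  move=> /(edge_neq dp) n; have : pos p uv.1 != pos p uv.2.
    by apply: contra_neq n => /pos_inj.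
  by clear; lia.
move: le; rewrite (bigD1 (u, v)) //= [leqRHS](bigD1 (u, v)) //=.
have : \sum_(i | graph es i.1 i.2 && (i != (u, v))) 1 <=
   \sum_(i | graph es i.1 i.2 && (i != (u, v)))
     ((pos p i.2 - pos p i.1) + (pos p i.1 - pos p i.2)).
  by apply: leq_sum => i /andP[/ge1].
have := ge1 (u, v) guv; rewrite /consec -!/(pos p _) /=.
move: (\sum_(_ | _) _) (\sum_(_ | _) _) => a b; lia.
Qed.
End Minla.

(** * Expected cost of the whole run *)

Section Potential.
Local Open Scope ring_scope.
Context {R : realType} {V : finType}.
Implicit Types (h es : seq (V * V)) (p q : arrangement V).

Lemma weight_bounds h u v : u != v -> (0 < weight h u v <= #|V| ^ 2)%N.
Proof.
move=> nuv; rewrite /weight.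
have cV w : (#|component (graph h) w| <= #|V|)%N by apply: max_card.
case: ifP => uv; last by rewrite muln_gt0 !card_component_gt0 -mulnn leq_mul.
rewrite bin_gt0; apply/andP; split.
  have -> : 2%N = #|[set u; v]| by rewrite cards2 nuv.
  apply/subset_leq_card/subsetP => w; rewrite !inE => /orP[/eqP->|/eqP->] //.
  by move: uv; rewrite inE.
apply: leq_trans (_ : #|component (graph h) u| ^ 2 <= _)%N; last by rewrite leq_exp2r.
rewrite bin2 -divn2 -mulnn; apply: leq_trans (leq_div _ _) _.
by rewrite leq_mul2l leq_pred orbT.
Qed.

Lemma potential_ge0 h p q : 0 <= potential R h p q.
Proof.
apply: sumr_ge0 => u _; apply: sumr_ge0 => v _.
case: (eqVneq u v) => [->|/(weight_bounds h)/andP[w0 wV]].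
  by rewrite /inverted eqxx mul0r.
apply: mulr_ge0 => //; rewrite subr_ge0 ler_ln ?ler_nat // posrE ltr0n //.
exact: leq_trans wV.
Qed.

Lemma component_nil (u : V) : component (graph [::]) u = [set u].
Proof.
apply/setP=> v; rewrite !inE; apply/connectP/eqP => [[s]|->]; last by exists [::].
by case: s => //= x s /andP[].
Qed.

Lemma potential_nil p q :
  potential R [::] p q = 2 * ln #|V|%:R * (inversions p q)%:R.
Proof.
case: (pickP (mem V)) => [x0 _|V0]; last first.
  rewrite /potential /inversions big_pred0 // eq_card0 ?mulr0 // => -[u v].
  by have := V0 u.
have V1 : (0 < #|V|)%N by apply/card_gt0P; exists x0.
have term u v : (inverted p q u v)%:R * (ln ((#|V| ^ 2)%:R) - ln ((weight [::] u v)%:R))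
    = (inverted p q u v)%:R * (2 * ln #|V|%:R) :> R.
  case: (eqVneq u v) => [->|nuv]; first by rewrite /inverted eqxx !mul0r.
  rewrite /weight !component_nil in_set1 eq_sym (negbTE nuv) !cards1 ln1 subr0.
  by congr (_ * _); rewrite natrX lnXn ?ltr0n // mulr_natl.
rewrite /potential (eq_bigr _ (fun u _ => eq_bigr _ (fun v _ => term u v))).
rewrite pair_bigA /= -mulr_suml mulrC -natr_sum; congr (_ * _%:R).
rewrite /inversions -sum1_card [RHS]big_mkcond; apply: eq_bigr => uv _.
by rewrite inE; case: inverted.
Qed.

Lemma update_prob_ge0 h p e w : 0 <= update_prob h p e R w.
Proof. by rewrite mulr_ge0 // divr_ge0. Qed.

Lemma sum_tuple_cons (T : finType) n (F : seq T -> R) :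
  \sum_(ws : n.+1.-tuple T) F ws = \sum_w \sum_(ws : n.-tuple T) F (w :: ws).
Proof.
rewrite pair_bigA /=.
rewrite (reindex (fun x : T * n.-tuple T => cons_tuple x.1 x.2)) //=.
exists (fun t => (thead t, behead_tuple t)) => [[w ws] _|t _] /=.
  by congr (_, _); apply: val_inj.
  by case/tupleP: t => w ws; rewrite theadE; apply: val_inj.
Qed.

(** The joining condition of [line_instance] relative to a history [h], as the induction over the
    remaining edges requires. *)
Definition distinct_joins h es : Prop :=
  forall es1 x z es2, es = rcons es1 (x, z) ++ es2 ->
    component (graph (h ++ es1)) x != component (graph (h ++ es1)) z.

Lemma distinct_joins_cons h e es : distinct_joins h (e :: es) ->
  component (graph h) e.1 != component (graph h) e.2 /\ distinct_joins (rcons h e) es.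
Proof.
move=> d; split.
  by have := d [::] e.1 e.2 es; rewrite cats0 -surjective_pairing; apply.
by move=> es1 x z es2 ees; rewrite cat_rcons; apply: (d (e :: es1) x z es2); rewrite ees.
Qed.

Lemma sum_rand_prob h p es : distinct_joins h es ->
  \sum_(ws : (size es).-tuple (bool * bool)) rand_prob R h p es ws = 1.
Proof.
elim: es h p => [|e es IH] h p d.
  by rewrite (eq_bigr (fun=> 1)) //= sumr_const card_tuple expn0.
have [nXZ d'] := distinct_joins_cons d.
rewrite (sum_tuple_cons _ (fun ws => rand_prob R h p (e :: es) ws)) /=.
rewrite -[RHS](update_prob_sum p R nXZ); apply: eq_bigr => w _.
by rewrite -mulr_sumr IH // mulr1.
Qed.

(** Induction along the run with [q] fixed: [potential_step] pays for one update, [update_tight]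
    restores the hypothesis on the permutation, and the potential left at the end is nonnegative. *)
Lemma expected_cost_le_potential q h p es : distinct_joins h es ->
  tight h p -> tight (h ++ es) q ->
  \sum_(ws : (size es).-tuple (bool * bool))
     rand_prob R h p es ws * (rand_cost h p es ws)%:R <= potential R h p q.
Proof.
elim: es h p => [|e es IH] h p d tp tq.
  by rewrite big1 ?potential_ge0 // => ws _; rewrite /= mulr0.
have [nXZ d'] := distinct_joins_cons d.
have tq1 : tight (rcons h e) q.
  by apply: tight_sub tq => x; rewrite mem_rcons mem_cat !inE => /orP[->|->]; rewrite ?orbT.
rewrite -cat_rcons in tq.
rewrite (sum_tuple_cons _ (fun ws => rand_prob R h p (e :: es) ws
  * (rand_cost h p (e :: es) ws)%:R)) /=.
apply: le_trans (potential_step nXZ tp tq1); apply: ler_sum => w _.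
have [b eb] := target_filter_joined nXZ tp tq1.
have tp' := update_tight nXZ tp tq1 eb w.
have -> : \sum_(ws : (size es).-tuple (bool * bool))
      update_prob h p e R w * rand_prob R (rcons h e) (update h p e w) es ws *
        (update_cost h p e w + rand_cost (rcons h e) (update h p e w) es ws)%:R =
    update_prob h p e R w * ((update_cost h p e w)%:R +
      \sum_(ws : (size es).-tuple (bool * bool))
        rand_prob R (rcons h e) (update h p e w) es ws *
          (rand_cost (rcons h e) (update h p e w) es ws)%:R).
  (* The cost of the current update does not depend on the later coins, whose probabilities sum to
     1. *)
  rewrite -[X in _ = _ * (X + _)]mulr1.
  rewrite -[X in _ = _ * (_ * X + _)](sum_rand_prob (update h p e w) d').
  rewrite mulr_sumr -big_split mulr_sumr /=; apply: eq_bigr => ws _.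
  rewrite natrD; ring.
by rewrite ler_wpM2l ?update_prob_ge0 // lerD2l IH.
Qed.
End Potential.

Theorem theorem8 (R : realType) (V : finType) (n : nat) (hn : #|V| = n)
    (pi0 : arrangement V) (es : seq (V * V)) (hes : line_instance es) :
  (expected_rand_cost R pi0 es <= 8%:R * ln (n%:R : R) * (opt pi0 es)%:R)%R.
Proof.
case: hes => dp joins; rewrite -hn.
rewrite /opt; case: ex_minnP => c /existsP[sol /andP[/forallP feas /eqP <-]] _.
pose q := last pi0 sol.
have tq : tight es q.
  apply: minla_tight; first by have := dp (size es) (leqnn _); rewrite take_size.
  (* Without edges [q] is [pi0], not constrained by feasibility, but then every permutation has cost
     0. *)
  case: (posnP (size es)) => [e0|es0].
    by apply/forallP => p; rewrite /arrangement_cost (size0nil e0) big1 // => x _;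
      rewrite big1.
  have lt_es : (size es).-1 < size es by rewrite prednK.
  have := feas (Ordinal lt_es); rewrite /= prednK // take_size.
  by rewrite (tnth_nth pi0) /= /q -nth_last size_tuple.
have lnV : (0 <= ln (#|V|%:R : R))%R.
  have [V0|V0] := posnP #|V|; first by rewrite V0 ln0.
  by rewrite ln_ge0 // ler1n.
have E : (expected_rand_cost R pi0 es <= potential R [::] pi0 q)%R.
  by apply: expected_cost_le_potential; first exact: joins.
apply: (le_trans E); rewrite potential_nil.
have h : ((inversions pi0 q)%:R <= 2 * (solution_cost pi0 sol)%:R :> R)%R.
  by rewrite -natrM ler_nat solution_inversions.
have := ler_wpM2l lnV h.
(* The bounds so far give 4 ln n times the cost of the optimal solution; nonnegativity of this
   product weakens it to 8 ln n. *)
have : (0 <= ln (#|V|%:R : R) * (solution_cost pi0 sol)%:R)%R by rewrite mulr_ge0.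
lra.
Qed.
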